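(* Fix an integer $\Lambda \ge 2$. Let $G=(V,E)$ be a loopless series-parallel graph of maxmaxflow at most $\Lambda$, and let the edge weights $\mathbf v=(v_e)_{e\in E}$ be real numbers with $v_e\in[-1,0]$ for all $e$. Then every root $q\in\mathbb{C}$ of $q\mapsto Z_G(q,\mathbf v)$ satisfies $|q-1| < (\Lambda-1)/\log 2$.
   Context: Graphs are finite and undirected and may have loops and multiple edges. For a graph $G=(V,E)$, $q\in\mathbb{C}$ and edge weights $\mathbf v=(v_e)_{e\in E}$, the multivariate Tutte polynomial is $Z_G(q,\mathbf v)=\sum_{A\subseteq E} q^{k(A)}\prod_{e\in A} v_e$, where $k(A)$ is the number of connected components of the spanning subgraph $(V,A)$. For distinct vertices $x,y$, $\lambda_G(x,y)$ denotes the maximum number of pairwise edge-disjoint paths from $x$ to $y$; the maxmaxflow of $G$ is $\Lambda(G)=\max_{x\neq y}\lambda_G(x,y)$ (taken to be $0$ if $G$ has fewer than two vertices). A loopless graph is series-parallel if it can be obtained from a forest by a finite (possibly empty) sequence of operations, each of which replaces an edge either by two edges in series (i.e. subdivides it with a new vertex of degree 2) or by two parallel edges with the same endpoints. *)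

(* Defs.v *)
From Stdlib Require Import Reals.
From mathcomp Require Import all_boot.

Set Implicit Arguments.
Unset Strict Implicit.
Unset Printing Implicit Defensive.

Record Cx := mkC { Re : R; Im : R }.
Definition Czero : Cx := mkC R0 R0.
Definition Cone : Cx := mkC R1 R0.
Definition RtoC (r : R) : Cx := mkC r R0.
Definition Cadd (z w : Cx) : Cx := mkC (Rplus (Re z) (Re w)) (Rplus (Im z) (Im w)).
Definition Csub (z w : Cx) : Cx := mkC (Rminus (Re z) (Re w)) (Rminus (Im z) (Im w)).
Definition Cmul (z w : Cx) : Cx :=
  mkC (Rminus (Rmult (Re z) (Re w)) (Rmult (Im z) (Im w)))
      (Rplus (Rmult (Re z) (Im w)) (Rmult (Im z) (Re w))).
Fixpoint Cpow (z : Cx) (n : nat) : Cx :=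
  match n with O => Cone | S k => Cmul z (Cpow z k) end.
Definition Cmod (z : Cx) : R := sqrt (Rplus (Rmult (Re z) (Re z)) (Rmult (Im z) (Im z))).

(* Finite undirected multigraphs (loops and multiple edges allowed).   *)
(* Vertices are 0, ..., nv-1; edges are the indices 0, ..., size es-1 *)
(* of the list es, the edge with index e having endpoints nth e es.   *)
Record graph := Graph { nv : nat; es : seq (nat * nat) }.

Definition ne (G : graph) : nat := size (es G).
Definition ends (G : graph) (e : nat) : nat * nat := nth (0, 0) (es G) e.

Definition wf_graph (G : graph) : Prop :=
  forall e, e < ne G -> (ends G e).1 < nv G /\ (ends G e).2 < nv G.

Definition loopless (G : graph) : Prop :=
  forall e, e < ne G -> (ends G e).1 <> (ends G e).2.

Definition joins (G : graph) (e u w : nat) : bool :=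
  ((ends G e).1 == u) && ((ends G e).2 == w)
  || ((ends G e).1 == w) && ((ends G e).2 == u).

Definition is_path (G : graph) (x y : nat) (p : seq nat) : Prop :=
  all (fun e => e < ne G) p /\
  exists vs : seq nat,
    [/\ size vs = size p, uniq (x :: vs), last x vs = y &
        forall i, i < size p ->
          joins G (nth 0 p i) (nth x (x :: vs) i) (nth x vs i)].

Definition edge_disjoint (P : seq (seq nat)) : Prop :=
  forall i j, i < size P -> j < size P -> i <> j ->
    forall e, e \in nth [::] P i -> e \notin nth [::] P j.

Definition lambda_le (G : graph) (x y L : nat) : Prop :=
  forall P : seq (seq nat),
    (forall p, p \in P -> is_path G x y p) -> edge_disjoint P -> size P <= L.

Definition maxmaxflow_le (G : graph) (L : nat) : Prop :=
  forall x y, x < nv G -> y < nv G -> x <> y -> lambda_le G x y L.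

Definition has_cycle (G : graph) : Prop :=
  exists e, e < ne G /\
    ((ends G e).1 = (ends G e).2 \/
     exists p, is_path G (ends G e).1 (ends G e).2 p /\ e \notin p).

Definition forest (G : graph) : Prop := wf_graph G /\ ~ has_cycle G.

Definition series_ext (G : graph) (i : nat) : graph :=
  Graph (nv G).+1
    (rcons (set_nth (0, 0) (es G) i ((ends G i).1, nv G))
           (nv G, (ends G i).2)).

Definition parallel_ext (G : graph) (i : nat) : graph :=
  Graph (nv G) (rcons (es G) (ends G i)).

Definition graph_iso (G H : graph) : Prop :=
  nv G = nv H /\ ne G = ne H /\
  exists (f p : nat -> nat),
    [/\ (forall x, x < nv G -> f x < nv G),
        (forall x y, x < nv G -> y < nv G -> f x = f y -> x = y),
        (forall j, j < ne G -> p j < ne G),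
        (forall j k, j < ne G -> k < ne G -> p j = p k -> j = k) &
        forall j, j < ne G ->
          ends H j = (f (ends G (p j)).1, f (ends G (p j)).2) \/
          ends H j = (f (ends G (p j)).2, f (ends G (p j)).1)].

Inductive series_parallel : graph -> Prop :=
| SP_forest G : forest G -> series_parallel G
| SP_series G i : series_parallel G -> i < ne G -> series_parallel (series_ext G i)
| SP_parallel G i : series_parallel G -> i < ne G -> series_parallel (parallel_ext G i)
| SP_iso G H : series_parallel G -> graph_iso G H -> series_parallel H.

Definition adjA (G : graph) (A : {set 'I_(ne G)}) : rel 'I_(nv G) :=
  fun u w => [exists e in A, joins G e u w].

Definition ncomp (G : graph) (A : {set 'I_(ne G)}) : nat :=
  n_comp (adjA A) 'I_(nv G).

Definition Ztutte (G : graph) (q : Cx) (v : nat -> R) : Cx :=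
  \big[Cadd/Czero]_(A : {set 'I_(ne G)})
     Cmul (Cpow q (ncomp A)) (RtoC (\big[Rmult/R1]_(e in A) v e)).

(* Main.v *)
Require Import Defs.
From Stdlib Require Import Reals Lra.
From HB Require Import structures.
From mathcomp Require Import all_boot ssralg ssrnum ssrint zify.

(* Write z = q - 1, Q = |z| and let t = v / (q + v) be the transmissivity of an
   edge.  Undoing the series-parallel construction turns G into a forest, two
   series edges being replaced by one edge of transmissivity t1 t2 and two
   parallel edges by one edge with 1 + v = (1 + v1)(1 + v2).  An edge obtained
   on the way also carries a capacity, namely a flow which the part of G it
   stands for can transport.  If Q >= (L - 1) / log 2, every edge lying on a
   cycle keeps |t| <= 1/Q.  Indeed a series connection then has |t| <= 1/Q^2; at
   most L - 1 series connections can be put in parallel as long as the result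
   still lies on a cycle, and by W^(L-1) <= 2Q/(Q+1), where W = Q(Q+1)/(Q^2+1),
   this brings |t| from 1/Q^2 up to 1/Q at most; real weights in [-1, 0] put in
   parallel multiply 1 + v by a number in [0, 1] and are harmless, because the
   disc |t| <= 1/Q is star-shaped about 1 + v = 0.  Hence no reduction produces a
   vanishing factor, and the partition function of the final forest, a product
   of factors q + v and of powers of q, does not vanish.  The capacities are
   controlled by cuts: max-flow min-cut supplies a cut of size at most L for
   every pair of vertices of G, and such cuts survive every reduction. *)

Set Implicit Arguments.
Unset Strict Implicit.
Unset Printing Implicit Defensive.

Delimit Scope R_scope with real.

(** * Real estimates *)

Local Open Scope R_scope.

Lemma nonneg_of_deriv (f f' : R -> R) (x : R) :
  0 <= x -> f 0 = 0 ->
  (forall c, 0 <= c <= x -> derivable_pt_lim f c (f' c)) ->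
  (forall c, 0 <= c <= x -> 0 <= f' c) -> 0 <= f x.
Proof.
move=> x0 f0 df f'0; case: (Req_dec x 0) => [->|xN0]; first by rewrite f0; lra.
have xp : 0 < x by lra.
have [c [fE [c0 cx]]] := MVT_cor2 f f' 0 x xp df.
have := f'0 c; nra.
Qed.

Lemma derivable_pt_lim_ln1p (c : R) :
  0 <= c -> derivable_pt_lim (fun x => ln (1 + x)) c (/ (1 + c)).
Proof.
move=> c0; have -> : / (1 + c) = / (1 + c) * (0 + 1) by ring.
apply: (derivable_pt_lim_comp (fun x => 1 + x) ln).
- exact: (derivable_pt_lim_plus (fun _ => 1) id c 0 1
    (derivable_pt_lim_const 1 c) (derivable_pt_lim_id c)).
- by apply: derivable_pt_lim_ln; lra.
Qed.

(** Vanishing coefficients are allowed, so that the numerators and denominators of both rational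
    bounds below are instances. *)
Lemma derivable_pt_lim_quadratic (a b d c : R) :
  derivable_pt_lim (fun x => a + b * x + d * (x * x)) c (b + 2 * d * c).
Proof.
have -> : b + 2 * d * c = (0 + b * 1) + d * (1 * c + c * 1) by ring.
apply: (derivable_pt_lim_plus (fun x => a + b * x) (fun x => d * (x * x))).
- apply: (derivable_pt_lim_plus (fun _ => a) (fun x => b * x)).
  + exact: derivable_pt_lim_const.
  + apply: (derivable_pt_lim_scal id); exact: derivable_pt_lim_id.
- apply: (derivable_pt_lim_scal (fun x => x * x)).
  apply: (derivable_pt_lim_mult id id); exact: derivable_pt_lim_id.
Qed.

(** This is the [1/1] Pade approximant of ln (1 + u); the difference has derivative u^2 / ((1 + u)(2
    + u)^2) >= 0. *)
Lemma ln1p_ge (u : R) : 0 <= u -> 2 * u / (2 + u) <= ln (1 + u).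
Proof.
move=> u0.
suff : 0 <= ln (1 + u) - (0 + 2 * u + 0 * (u * u)) / (2 + 1 * u + 0 * (u * u)).
  have -> : (0 + 2 * u + 0 * (u * u)) / (2 + 1 * u + 0 * (u * u)) = 2 * u / (2 + u).
    by field; lra.
  lra.
apply: (@nonneg_of_deriv
  (fun u => ln (1 + u) - (0 + 2 * u + 0 * (u * u)) / (2 + 1 * u + 0 * (u * u)))
  (fun u => u * u / ((1 + u) * ((2 + u) * (2 + u))))) => //.
- by rewrite Rplus_0_r ln_1; field.
- move=> c [c0 _].
  have -> : c * c / ((1 + c) * ((2 + c) * (2 + c))) =
    / (1 + c) - ((2 + 2 * 0 * c) * (2 + 1 * c + 0 * (c * c)) -
       (1 + 2 * 0 * c) * (0 + 2 * c + 0 * (c * c))) / Rsqr (2 + 1 * c + 0 * (c * c)).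
    by rewrite /Rsqr; field; lra.
  apply: (derivable_pt_lim_minus (fun x => ln (1 + x))); first exact: derivable_pt_lim_ln1p.
  apply: (derivable_pt_lim_div (fun x => 0 + 2 * x + 0 * (x * x))
            (fun x => 2 + 1 * x + 0 * (x * x))); try exact: derivable_pt_lim_quadratic.
  lra.
- move=> c [c0 _]; apply: Rmult_le_pos; first nra.
  by apply/Rlt_le/Rinv_0_lt_compat; nra.
Qed.

(** The [2/1] Pade approximant bounds from above: the difference has derivative 4 u^3 / ((1 + u)(6 +
    4 u)^2). *)
Lemma ln1p_le (u : R) : 0 <= u -> ln (1 + u) <= u * (6 + u) / (6 + 4 * u).
Proof.
move=> u0.
suff : 0 <= (0 + 6 * u + 1 * (u * u)) / (6 + 4 * u + 0 * (u * u)) - ln (1 + u).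
  have -> : (0 + 6 * u + 1 * (u * u)) / (6 + 4 * u + 0 * (u * u)) = u * (6 + u) / (6 + 4 * u).
    by field; lra.
  lra.
apply: (@nonneg_of_deriv
  (fun u => (0 + 6 * u + 1 * (u * u)) / (6 + 4 * u + 0 * (u * u)) - ln (1 + u))
  (fun u => 4 * (u * (u * u)) / ((1 + u) * ((6 + 4 * u) * (6 + 4 * u))))) => //.
- by rewrite Rplus_0_r ln_1; field.
- move=> c [c0 _].
  have -> : 4 * (c * (c * c)) / ((1 + c) * ((6 + 4 * c) * (6 + 4 * c))) =
    ((6 + 2 * 1 * c) * (6 + 4 * c + 0 * (c * c)) -
       (4 + 2 * 0 * c) * (0 + 6 * c + 1 * (c * c))) / Rsqr (6 + 4 * c + 0 * (c * c))
    - / (1 + c).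
    by rewrite /Rsqr; field; lra.
  apply: (derivable_pt_lim_minus
            (fun x => (0 + 6 * x + 1 * (x * x)) / (6 + 4 * x + 0 * (x * x)))).
    apply: (derivable_pt_lim_div (fun x => 0 + 6 * x + 1 * (x * x))
            (fun x => 6 + 4 * x + 0 * (x * x))); try exact: derivable_pt_lim_quadratic.
    lra.
  exact: derivable_pt_lim_ln1p.
- move=> c [c0 _]; apply: Rmult_le_pos.
    by have := Rmult_le_pos _ _ c0 c0; nra.
  by apply/Rlt_le/Rinv_0_lt_compat; nra.
Qed.

Lemma ln2_ge : 2 / 3 <= ln 2.
Proof. by have := @ln1p_ge 1; have -> : 1 + 1 = 2 by []; lra. Qed.

Lemma ln2_le : ln 2 <= 7 / 10.
Proof. by have := @ln1p_le 1; have -> : 1 + 1 = 2 by []; lra. Qed.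

(** The value of (1 + Q rho) / (1 + rho) at rho = 1/Q^2, the transmissivity radius of a series
    connection. *)
Definition growth (Q : R) : R := Q * (Q + 1) / (Q * Q + 1).

(** The right-hand side is (1 + Q rho) / (1 + rho) at rho = 1/Q. As [growth Q] is at least 1, the
    worst exponent is Q ln 2; after taking logarithms, the Pade bounds leave a polynomial inequality
    in x = 1/Q on 0 < x <= ln 2. *)
Lemma growth_pow_le (n : nat) (Q : R) :
  (0 < n)%nat -> INR n <= Q * ln 2 -> growth Q ^ n <= 2 * Q / (Q + 1).
Proof.
move=> n0 nQ; have l1 := ln2_ge; have l2 := ln2_le.
have n1 : 1 <= INR n by apply: (le_INR 1); apply/leP.
have Q1 : 1 / ln 2 <= Q.
  apply: (Rmult_le_reg_r (ln 2)); first lra.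
  by rewrite /Rdiv Rmult_1_l Rinv_l; lra.
have Q0 : 1 < Q by nra.
set x := / Q.
have x0 : 0 < x by apply: Rinv_0_lt_compat; lra.
have xQ : x * Q = 1 by apply: Rinv_l; lra.
have xl : x <= ln 2 by nra.
have growthE : growth Q = (1 + x) / (1 + x * x).
  by rewrite /growth /x; field; split; nra.
have g1 : 0 < 1 + x by lra.
have g2 : 0 < 1 + x * x by nra.
have gp : 0 < growth Q by rewrite growthE; apply: Rdiv_lt_0_compat.
have rE : 2 * Q / (Q + 1) = 2 / (1 + x) by rewrite /x; field; lra.
have rp : 0 < 2 / (1 + x) by apply: Rdiv_lt_0_compat; lra.
rewrite rE -Rpower_pow // -(exp_ln _ rp) /Rpower.
(* Q times this inequality is the claim for the exponent Q ln 2. *)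
have key : ln 2 * (ln (1 + x) - ln (1 + x * x)) + x * ln (1 + x) <= x * ln 2.
  have b1 := @ln1p_le x (Rlt_le _ _ x0).
  have xx0 : 0 <= x * x by nra.
  have b2 := ln1p_ge xx0.
  suff : ln 2 * (x * (6 + x) / (6 + 4 * x) - 2 * (x * x) / (2 + x * x))
         + x * (x * (6 + x) / (6 + 4 * x)) <= x * ln 2 by nra.
  set c := ln 2 in l1 l2 xl *.
  have -> : c * (x * (6 + x) / (6 + 4 * x) - 2 * (x * x) / (2 + x * x))
         + x * (x * (6 + x) / (6 + 4 * x)) =
    x * c - x * x * ((18 * c - 12) + (8 * c - 2) * x + (3 * c - 6) * (x * x) - x * (x * x))
       / ((6 + 4 * x) * (2 + x * x)).
    by field; split; nra.
  suff : 0 <= x * x * ((18 * c - 12) + (8 * c - 2) * x + (3 * c - 6) * (x * x) - x * (x * x))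
       / ((6 + 4 * x) * (2 + x * x)) by lra.
  apply: Rmult_le_pos; last by apply/Rlt_le/Rinv_0_lt_compat; nra.
  apply: Rmult_le_pos => //.
  (* The constant term 18 c - 12 is nonnegative by ln 2 >= 2/3; what remains is divisible by x. *)
  suff : 0 <= x * ((8 * c - 2) + (3 * c - 6) * x - x * x) by nra.
  apply: Rmult_le_pos; first lra.
  nra.
have lnle : INR n * ln (growth Q) <= ln (2 / (1 + x)).
  rewrite growthE /Rdiv !ln_mult ?ln_Rinv //; try exact: Rinv_0_lt_compat; try lra.
  have lw : 0 <= ln (1 + x) - ln (1 + x * x).
    suff : ln (1 + x * x) <= ln (1 + x) by lra.
    have : x * x < x by nra.
    by move=> xx; apply/Rlt_le/ln_increasing; lra.
  have : INR n * (ln (1 + x) - ln (1 + x * x)) <=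
         Q * ln 2 * (ln (1 + x) - ln (1 + x * x)) by nra.
  have : Q * (ln 2 * (ln (1 + x) - ln (1 + x * x)) + x * ln (1 + x)) <= Q * (x * ln 2) by nra.
  rewrite Rmult_plus_distr_l -!Rmult_assoc [Q * x]Rmult_comm xQ !Rmult_1_l.
  lra.
case: lnle => [lt|->]; last exact: Rle_refl.
exact/Rlt_le/exp_increasing.
Qed.

(** * Complex numbers and edge weights *)

(** Decidable equality makes labelled edges an [eqType], as membership and [perm_eq] require. *)
Lemma Cx_eqP : Equality.axiom (fun z w : Cx =>
  (Req_EM_T (Re z) (Re w) : bool) && (Req_EM_T (Im z) (Im w) : bool)).
Proof.
move=> [a b] [c d] /=.
case: Req_EM_T => [ac|ne] /=; last by constructor; case.
case: Req_EM_T => [bd|ne] /=; last by constructor; case.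
by constructor; rewrite ac bd.
Qed.

HB.instance Definition _ := hasDecEq.Build Cx Cx_eqP.

Definition Copp (z : Cx) : Cx := mkC (- Re z) (- Im z).

Lemma R0E : R0 = 0. Proof. by []. Qed.
Lemma R1E : R1 = 1. Proof. by []. Qed.

Lemma Cx_eq (z w : Cx) : Re z = Re w -> Im z = Im w -> z = w.
Proof. by case: z w => [a b] [c d] /= -> ->. Qed.

Lemma Cx_ring : ring_theory Czero Cone Cadd Cmul Csub Copp (@eq Cx).
Proof. by split=> *; apply: Cx_eq; rewrite /= ?R1E ?R0E; ring. Qed.

Add Ring Cx : Cx_ring.

Lemma Cmod_ge0 (z : Cx) : 0 <= Cmod z.
Proof. exact: sqrt_pos. Qed.

Lemma Cmod_sqr (z : Cx) : Cmod z * Cmod z = Re z * Re z + Im z * Im z.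
Proof. by rewrite sqrt_sqrt; nra. Qed.

Lemma Cmod_eq0 (z : Cx) : Cmod z = 0 -> z = Czero.
Proof.
case: z => a b /(f_equal (fun x => x * x)); rewrite Cmod_sqr /= => h.
by apply: Cx_eq => /=; rewrite ?R0E; nra.
Qed.

Lemma Cmod_gt0 (z : Cx) : z <> Czero -> 0 < Cmod z.
Proof.
by move=> z0; case: (Cmod_ge0 z) => // h; case: z0; apply: Cmod_eq0.
Qed.

Lemma Cmod_mul (z w : Cx) : Cmod (Cmul z w) = Cmod z * Cmod w.
Proof. by rewrite /Cmod -sqrt_mult /=; try nra; congr sqrt; ring. Qed.

Lemma Cmod_add (z w : Cx) : Cmod (Cadd z w) <= Cmod z + Cmod w.
Proof.
have [z0 w0] := (Cmod_ge0 z, Cmod_ge0 w).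
apply: Rsqr_incr_0_var; last lra.
rewrite /Rsqr Cmod_sqr /=.
(* Cauchy-Schwarz: the squares differ by (Re z Im w - Im z Re w)^2. *)
have dot : Re z * Re w + Im z * Im w <= Cmod z * Cmod w.
  apply: Rsqr_incr_0_var; last nra.
  rewrite /Rsqr.
  have -> : Cmod z * Cmod w * (Cmod z * Cmod w) =
    (Cmod z * Cmod z) * (Cmod w * Cmod w) by ring.
  rewrite !Cmod_sqr.
  have := Rle_0_sqr (Re z * Im w - Im z * Re w); rewrite /Rsqr; lra.
have := Cmod_sqr z; have := Cmod_sqr w; lra.
Qed.

Lemma Cmod_sub_ge (z w : Cx) : Cmod z - Cmod w <= Cmod (Cadd z w).
Proof.
have := Cmod_add (Cadd z w) (Copp w).
have -> : Cadd (Cadd z w) (Copp w) = z by ring.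
have -> : Cmod (Copp w) = Cmod w by rewrite /Cmod /=; congr sqrt; ring.
lra.
Qed.

Lemma Cmod0 : Cmod Czero = 0.
Proof. by rewrite /Cmod /= -sqrt_0; congr sqrt; rewrite ?R0E; ring. Qed.

Lemma Cmod_RtoC (r : R) : 0 <= r -> Cmod (RtoC r) = r.
Proof.
move=> r0; rewrite /Cmod /= -[RHS]sqrt_square //; congr sqrt; rewrite ?R0E; ring.
Qed.

Lemma Cmul_neq0 (z w : Cx) : z <> Czero -> w <> Czero -> Cmul z w <> Czero.
Proof.
move=> /Cmod_gt0 z0 /Cmod_gt0 w0 h; have := Cmod_mul z w; rewrite h Cmod0; nra.
Qed.

Lemma Cpow_neq0 (z : Cx) (n : nat) : z <> Czero -> Cpow z n <> Czero.
Proof.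
move=> z0; elim: n => [|n ih] /=; last exact: Cmul_neq0.
by case=> h; lra.
Qed.

Lemma CpowD (z : Cx) (m n : nat) : Cpow z (m + n) = Cmul (Cpow z m) (Cpow z n).
Proof. by elim: m => [|m ih] /=; rewrite ?add0n ?addSn /= ?ih; ring. Qed.

(* An edge carries homogeneous coordinates [(a, b)] of its weight [v = b / a];
   this keeps v = infinity legal, which series reductions of bridges produce.
   [wden q a b] is the denominator of the transmissivity [t = b / (q a + b)],
   and [a + b] stands for [1 + v]. *)
Definition wden (q a b : Cx) : Cx := Cadd (Cmul q a) b.

(* [|t| <= rho] where [(1 + Q rho) / (1 + rho) = W], i.e.
   [rho = (W - 1) / (Q - W)]; in this parametrisation parallel connection
   multiplies the [W]s. *)
Definition tbound (q : Cx) (W : R) (a b : Cx) : Prop :=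
  Cmod b * (Cmod (Csub q Cone) - W) <= (W - 1) * Cmod (wden q a b).

(** The factor [s] collects the values 1 + v of real edges put in parallel; [b0] is what remains,
    bounded by one factor [growth] per unit of capacity. *)
Definition wclass (q : Cx) (c : nat) (a b : Cx) : Prop :=
  exists (s : R) (b0 : Cx),
    [/\ 0 <= s <= 1, Cadd a b = Cmul (RtoC s) (Cadd a b0) &
        tbound q (growth (Cmod (Csub q Cone)) ^ c) a b0].

(** Chosen so that a1 a2 + [par_b] = (a1 + b1)(a2 + b2), that is, 1 + v = (1 + v1)(1 + v2). *)
Definition par_b (a1 b1 a2 b2 : Cx) : Cx :=
  Cadd (Cadd (Cmul a1 b2) (Cmul b1 a2)) (Cmul b1 b2).

(** With b = b1 b2 this is the series law v = v1 v2 / (q + v1 + v2), cleared of denominators. *)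
Definition ser_a (q a1 b1 a2 b2 : Cx) : Cx :=
  Cadd (Cmul q (Cmul a1 a2)) (Cadd (Cmul a1 b2) (Cmul b1 a2)).

Lemma wden_ser (q a1 b1 a2 b2 : Cx) :
  wden q (ser_a q a1 b1 a2 b2) (Cmul b1 b2) = Cmul (wden q a1 b1) (wden q a2 b2).
Proof. rewrite /wden /ser_a; ring. Qed.

(** Together with [par_b_wden] this is the parallel law t = (t1 + t2 + (q - 2) t1 t2) / (1 + (q - 1)
    t1 t2) without divisions. *)
Lemma wden_par (q a1 b1 a2 b2 : Cx) :
  Cmul q (wden q (Cmul a1 a2) (par_b a1 b1 a2 b2)) =
  Cadd (Cmul (wden q a1 b1) (wden q a2 b2)) (Cmul (Csub q Cone) (Cmul b1 b2)).
Proof. rewrite /wden /par_b; ring. Qed.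

Lemma par_b_wden (q a1 b1 a2 b2 : Cx) :
  Cmul q (par_b a1 b1 a2 b2) =
  Cadd (Cadd (Cmul b1 (wden q a2 b2)) (Cmul (wden q a1 b1) b2))
       (Cmul (Csub (Csub q Cone) Cone) (Cmul b1 b2)).
Proof. rewrite /wden /par_b; ring. Qed.

(** * Transmissivity bounds under series and parallel connection *)

Section Weights.
Variable q : Cx.
Let Q : R := Cmod (Csub q Cone).
Hypothesis Q1 : 1 < Q.

Lemma q_neq0 : q <> Czero.
Proof.
move=> q0; have : Q = 1 by rewrite /Q q0 -[RHS]sqrt_1; congr sqrt => /=; rewrite ?R0E ?R1E; ring.
lra.
Qed.

Lemma growth_ge1 : 1 <= growth Q.
Proof.
rewrite /growth; apply: (Rmult_le_reg_r (Q * Q + 1)); first nra.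
by rewrite /Rdiv Rmult_assoc Rinv_l; nra.
Qed.

Lemma growth_pow_ge1 (n : nat) : 1 <= growth Q ^ n.
Proof. exact: pow_R1_Rle growth_ge1. Qed.

(** If |t_i| <= rho_i = (W_i - 1)/(Q - W_i), the parallel law gives |t| <= (rho1 + rho2 + (Q + 1)
    rho1 rho2)/(1 - Q rho1 rho2). Over the common denominator [P] the two parts become (Q - 1)(W1 W2
    - 1) and (Q - 1)(Q - W1 W2). *)
Lemma tbound_par (W1 W2 : R) (a1 b1 a2 b2 : Cx) :
  1 <= W1 -> 1 <= W2 -> W1 * W2 < Q ->
  tbound q W1 a1 b1 -> tbound q W2 a2 b2 ->
  tbound q (W1 * W2) (Cmul a1 a2) (par_b a1 b1 a2 b2).
Proof.
rewrite /tbound -/Q => W11 W21 W12 t1 t2.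
set D1 := wden q a1 b1 in t1 *; set D2 := wden q a2 b2 in t2 *.
have q0 := Cmod_gt0 q_neq0.
have hb := Cmod_mul q (par_b a1 b1 a2 b2).
have hD := Cmod_mul q (wden q (Cmul a1 a2) (par_b a1 b1 a2 b2)).
rewrite par_b_wden -/D1 -/D2 in hb; rewrite wden_par -/D1 -/D2 in hD.
have ub : Cmod q * Cmod (par_b a1 b1 a2 b2) <=
  Cmod b1 * Cmod D2 + Cmod D1 * Cmod b2 + (Q + 1) * (Cmod b1 * Cmod b2).
  rewrite -hb.
  apply: Rle_trans (Cmod_add _ _) _; rewrite !Cmod_mul.
  have := Cmod_add (Cmul b1 D2) (Cmul D1 b2); rewrite !Cmod_mul => h1.
  have h2 : Cmod (Csub (Csub q Cone) Cone) <= Q + 1.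
    have := Cmod_add (Csub q Cone) (Copp Cone).
    have -> : Cadd (Csub q Cone) (Copp Cone) = Csub (Csub q Cone) Cone by ring.
    have -> : Cmod (Copp Cone) = 1 by rewrite /Cmod /= -[RHS]sqrt_1; congr sqrt; rewrite ?R0E ?R1E; ring.
    by [].
  have h3 : 0 <= Cmod b1 * Cmod b2 by apply: Rmult_le_pos; apply: Cmod_ge0.
  nra.
have lb : Cmod D1 * Cmod D2 - Q * (Cmod b1 * Cmod b2) <=
   Cmod q * Cmod (wden q (Cmul a1 a2) (par_b a1 b1 a2 b2)).
  rewrite -hD; apply: Rle_trans (Cmod_sub_ge _ _).
  by rewrite !Cmod_mul; apply: Rle_refl.
move: (Cmod_ge0 b1) (Cmod_ge0 b2) (Cmod_ge0 D1) (Cmod_ge0 D2) t1 t2 ub lb.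
move: (Cmod b1) (Cmod b2) (Cmod D1) (Cmod D2) => B1 B2 d1 d2 B10 B20 d10 d20 t1 t2 ub lb.
apply: (Rmult_le_reg_l (Cmod q)) => //.
have W1Q : W1 < Q by nra.
have W2Q : W2 < Q by nra.
set P := (Q - W1) * (Q - W2).
have P0 : 0 < P by rewrite /P; nra.
have e11 : 0 <= B1 * (Q - W1) by nra.
have e21 : 0 <= B2 * (Q - W2) by nra.
have e1 : B1 * d2 * P <= (W1 - 1) * (Q - W2) * (d1 * d2).
  have : (B1 * (Q - W1)) * ((Q - W2) * d2) <= ((W1 - 1) * d1) * ((Q - W2) * d2).
    by apply: Rmult_le_compat_r t1; apply: Rmult_le_pos; lra.
  rewrite /P; lra.
have e2 : d1 * B2 * P <= (W2 - 1) * (Q - W1) * (d1 * d2).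
  have : (B2 * (Q - W2)) * ((Q - W1) * d1) <= ((W2 - 1) * d2) * ((Q - W1) * d1).
    by apply: Rmult_le_compat_r t2; apply: Rmult_le_pos; lra.
  rewrite /P; lra.
have e3 : B1 * B2 * P <= (W1 - 1) * (W2 - 1) * (d1 * d2).
  have := Rmult_le_compat _ _ _ _ e11 e21 t1 t2; rewrite /P; lra.
set d := d1 * d2 in e1 e2 e3 lb *.
set X := Cmod q * _ in ub; set Z := Cmod q * _ in lb.
have -> : Cmod q * (Cmod (par_b a1 b1 a2 b2) * (Q - W1 * W2)) = X * (Q - W1 * W2) by rewrite /X; ring.
have -> : Cmod q * ((W1 * W2 - 1) * Cmod (wden q (Cmul a1 a2) (par_b a1 b1 a2 b2))) =
   (W1 * W2 - 1) * Z by rewrite /Z; ring.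
have hX : X * P <= (Q - 1) * (W1 * W2 - 1) * d.
  apply: (Rle_trans _ ((B1 * d2 + d1 * B2 + (Q + 1) * (B1 * B2)) * P)).
    by apply: Rmult_le_compat_r ub; lra.
  have Qp : 0 <= Q + 1 by lra.
  have := Rmult_le_compat_l (Q + 1) _ _ Qp e3; lra.
have hZ : (Q - 1) * (Q - W1 * W2) * d <= Z * P.
  apply: (Rle_trans _ ((d - Q * (B1 * B2)) * P)); last by apply: Rmult_le_compat_r lb; lra.
  have Qp : 0 <= Q by lra.
  have := Rmult_le_compat_l Q _ _ Qp e3; rewrite /P; lra.
have w1 : 0 <= W1 * W2 - 1 by nra.
have qw : 0 <= Q - W1 * W2 by lra.
apply: (Rmult_le_reg_r P) => //.
have h1 := Rmult_le_compat_r _ _ _ qw hX.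
have h2 := Rmult_le_compat_l _ _ _ w1 hZ.
lra.
Qed.

(** The radius belonging to W = 2Q/(Q + 1) is exactly 1/Q, and the radius increases with W. *)
Lemma tbound_disc (c : nat) (a b : Cx) :
  growth Q ^ c <= 2 * Q / (Q + 1) -> tbound q (growth Q ^ c) a b ->
  Q * Cmod b <= Cmod (wden q a b).
Proof.
rewrite /tbound -/Q; move: (growth Q ^ c) => W WQ h.
have WQ' : W * (Q + 1) <= 2 * Q.
  have -> : 2 * Q = 2 * Q / (Q + 1) * (Q + 1) by field; lra.
  by apply: Rmult_le_compat_r WQ; lra.
move: (Cmod_ge0 b) (Cmod_ge0 (wden q a b)) h; move: (Cmod b) (Cmod (wden q a b)) => B D B0 D0 h.
have h1 : B * (Q - W) * (Q + 1) <= (W - 1) * D * (Q + 1).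
  by apply: Rmult_le_compat_r h; lra.
have h2 : B * (2 * Q - W * (Q + 1)) >= 0 by apply/Rle_ge/Rmult_le_pos; lra.
have h3 : D * (2 * Q - W * (Q + 1)) >= 0 by apply/Rle_ge/Rmult_le_pos; lra.
apply: (Rmult_le_reg_l (Q - 1)); lra.
Qed.

(* In the coordinate [1 + v = (a + b) / a] the condition [|t| <= 1 / Q] is a
   disc containing 0, hence star-shaped about 0. *)
Lemma disc_star (s : R) (a b b0 : Cx) :
  0 <= s <= 1 -> Cadd a b = Cmul (RtoC s) (Cadd a b0) ->
  Q * Cmod b0 <= Cmod (wden q a b0) -> Q * Cmod b <= Cmod (wden q a b).
Proof.
move=> [s0 s1] abE h.
have Yb (x : Cx) : x = Csub (Cadd a x) a by ring.
have YD (x : Cx) : wden q a x = Cadd (Cmul (Csub q Cone) a) (Cadd a x).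
  by rewrite /wden; ring.
have QQ := Cmod_sqr (Csub q Cone); rewrite -/Q in QQ.
rewrite [b]Yb YD abE; rewrite [b0]Yb YD in h.
move: (Cadd a b0) h => Y h {abE}.
move: (Q) Q1 QQ h => K K1 QQ h.
move: (Csub q Cone) QQ h => z QQ h.
have sq (u w : R) : 0 <= u -> 0 <= w -> u * u <= w * w <-> u <= w.
  by move=> u0 w0; split=> ?; nra.
have p1 (x : Cx) : 0 <= K * Cmod x by apply: Rmult_le_pos; [lra|exact: Cmod_ge0].
apply/sq => //; first exact: Cmod_ge0.
move/(sq _ _ (p1 _) (Cmod_ge0 _)) in h.
have qsq (x : Cx) : K * Cmod x * (K * Cmod x) = (K * K) * (Re x * Re x + Im x * Im x).
  by rewrite -Cmod_sqr; ring.
rewrite qsq Cmod_sqr QQ; rewrite qsq Cmod_sqr QQ in h.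
(* Put F(Y) = |z a + Y|^2 - K^2 |Y - a|^2. Since |z| = K the |a|^2 terms cancel, so F(s Y) = s F(Y)
   + s (1 - s)(K^2 - 1)|Y|^2. *)
have QQ1 : 0 <= (K * K - 1) * (Re Y * Re Y + Im Y * Im Y).
  by apply: Rmult_le_pos; nra.
have le0 (x y : R) : 0 <= y - x <-> x <= y by split=> ?; lra.
have h1 := Rmult_le_pos _ _ s0 (proj2 (le0 _ _) h).
have ss : 0 <= s * (1 - s) by nra.
have h2 := Rmult_le_pos _ _ ss QQ1.
rewrite QQ in h2.
apply/le0; apply: Rle_trans (Rplus_le_le_0_compat _ _ h1 h2) _.
by right; rewrite /= R0E; ring.
Qed.

Lemma wclass_disc (c : nat) (a b : Cx) :
  growth Q ^ c <= 2 * Q / (Q + 1) -> wclass q c a b ->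
  Q * Cmod b <= Cmod (wden q a b).
Proof.
move=> gc [s [b0 [s01 abE tb]]].
exact: disc_star s01 abE (tbound_disc gc tb).
Qed.

Lemma wclass_par (c1 c2 : nat) (a1 b1 a2 b2 : Cx) :
  growth Q ^ (c1 + c2) <= 2 * Q / (Q + 1) ->
  wclass q c1 a1 b1 -> wclass q c2 a2 b2 ->
  wclass q (c1 + c2) (Cmul a1 a2) (par_b a1 b1 a2 b2).
Proof.
move=> gc [s1 [b1' [s1P e1 t1]]] [s2 [b2' [s2P e2 t2]]].
exists (s1 * s2), (par_b a1 b1' a2 b2'); split; first by nra.
- have parE (x y : Cx) : Cadd (Cmul a1 a2) (par_b a1 x a2 y) = Cmul (Cadd a1 x) (Cadd a2 y).
    by rewrite /par_b; ring.
  rewrite !parE e1 e2.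
  have -> : RtoC (s1 * s2) = Cmul (RtoC s1) (RtoC s2).
    by apply: Cx_eq => /=; rewrite ?R0E; ring.
  ring.
- rewrite -/Q pow_add in gc *.
  apply: tbound_par => //; try exact: growth_pow_ge1.
  (* Q > 1 gives 2Q/(Q + 1) < Q, so the combined factor stays below the pole of the radius. *)
  apply: Rle_lt_trans gc _.
  apply: (Rmult_lt_reg_r (Q + 1)); first lra.
  by rewrite /Rdiv Rmult_assoc Rinv_l; nra.
Qed.

(** If the denominator vanished, |D1 D2| = Q |b1 b2| by [wden_par], whereas the disc bounds give Q^2
    |b1 b2| <= |D1 D2|. *)
Lemma wden_par_neq0 (a1 b1 a2 b2 : Cx) :
  wden q a1 b1 <> Czero -> wden q a2 b2 <> Czero ->
  Q * Cmod b1 <= Cmod (wden q a1 b1) -> Q * Cmod b2 <= Cmod (wden q a2 b2) ->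
  wden q (Cmul a1 a2) (par_b a1 b1 a2 b2) <> Czero.
Proof.
move=> /Cmod_gt0 D1 /Cmod_gt0 D2 h1 h2 D0.
have := wden_par q a1 b1 a2 b2; rewrite D0.
have -> : Cmul q Czero = Czero by ring.
move/(f_equal Cmod); rewrite Cmod0.
have := Cmod_sub_ge (Cmul (wden q a1 b1) (wden q a2 b2)) (Cmul (Csub q Cone) (Cmul b1 b2)).
rewrite !Cmod_mul -/Q.
move: (Cmod_ge0 b1) (Cmod_ge0 b2) D1 D2 h1 h2.
move: (Cmod b1) (Cmod b2) (Cmod (wden q a1 b1)) (Cmod (wden q a2 b2)).
move=> B1 B2 d1 d2 B10 B20 d10 d20 h1 h2 le eq.
have h3 : (Q * B1) * (Q * B2) <= d1 * d2 by apply: Rmult_le_compat => //; nra.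
have d12 : 0 < d1 * d2 by nra.
have : Q * (d1 * d2) <= d1 * d2 by nra.
nra.
Qed.

(** Transmissivities multiply, and 1/Q^2 is the radius belonging to W = [growth Q]. Hence s = 1 and
    capacity 1, whatever the capacities of the two parts. *)
Lemma wclass_ser (a1 b1 a2 b2 : Cx) :
  Q * Cmod b1 <= Cmod (wden q a1 b1) -> Q * Cmod b2 <= Cmod (wden q a2 b2) ->
  wclass q 1 (ser_a q a1 b1 a2 b2) (Cmul b1 b2).
Proof.
move=> h1 h2; exists 1, (Cmul b1 b2); split; first lra.
  have -> : RtoC 1 = Cone by [].
  by ring.
rewrite /tbound pow_1 wden_ser !Cmod_mul -/Q.
have -> : Q - growth Q = Q * Q * ((Q - 1) / (Q * Q + 1)) by rewrite /growth; field; nra.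
have -> : growth Q - 1 = (Q - 1) / (Q * Q + 1) by rewrite /growth; field; nra.
have p : 0 <= (Q - 1) / (Q * Q + 1).
  by apply: Rmult_le_pos; [lra|apply/Rlt_le/Rinv_0_lt_compat; nra].
have h3 : (Q * Cmod b1) * (Q * Cmod b2) <= Cmod (wden q a1 b1) * Cmod (wden q a2 b2).
  by apply: Rmult_le_compat => //; apply: Rmult_le_pos; try exact: Cmod_ge0; lra.
have := Rmult_le_compat_l _ _ _ p h3; lra.
Qed.

(** Take s = 1 + v and b0 = 0: all of the weight goes into the star-shaped factor. *)
Lemma wclass_real (v : R) : -1 <= v <= 0 -> wclass q 1 Cone (RtoC v).
Proof.
move=> v01; exists (1 + v), Czero; split; first lra.
  by apply: Cx_eq => /=; rewrite ?R0E ?R1E; ring.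
rewrite /tbound Cmod0 Rmult_0_l pow_1; apply: Rmult_le_pos; last exact: Cmod_ge0.
by have := growth_ge1; rewrite -/Q; lra.
Qed.

(** q + v = (q - 1) + (1 + v) with |1 + v| <= 1 < Q. *)
Lemma wden_real_neq0 (v : R) : -1 <= v <= 0 -> wden q Cone (RtoC v) <> Czero.
Proof.
move=> v01 /(f_equal Cmod); rewrite Cmod0.
have -> : wden q Cone (RtoC v) = Cadd (Csub q Cone) (RtoC (1 + v)).
  by apply: Cx_eq => /=; rewrite ?R0E ?R1E; ring.
have := Cmod_sub_ge (Csub q Cone) (RtoC (1 + v)); rewrite Cmod_RtoC -/Q; lra.
Qed.

End Weights.

(** * Components *)

Local Open Scope nat_scope.

Definition edge_in (n : nat) (e : nat * nat) : bool := (e.1 < n) && (e.2 < n).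

(* Connectedness of u and w in A: no cut, given as a two-colouring of the
   vertices, separates u from w. *)
Definition conn (A : seq (nat * nat)) (u w : nat) : Prop :=
  forall s : nat -> bool, (forall e, e \in A -> s e.1 = s e.2) -> s u = s w.

Definition adjl (n : nat) (A : seq (nat * nat)) : rel 'I_n :=
  fun u w => ((u : nat, w : nat) \in A) || ((w : nat, u : nat) \in A).

(** Components are counted for a list of endpoint pairs, since reductions change the edges; locking
    keeps simplification from unfolding the count. *)
HB.lock Definition kl (n : nat) (A : seq (nat * nat)) : nat := n_comp (@adjl n A) 'I_n.

Lemma adjl_sym n A : connect_sym (@adjl n A).
Proof. by apply: sym_connect_sym => x y; rewrite /adjl orbC. Qed.

Lemma conn_sub A B u w : {subset A <= B} -> conn A u w -> conn B u w.
Proof. by move=> AB cA s sB; apply: cA => e /AB; apply: sB. Qed.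

Lemma connP n A (u w : 'I_n) :
  all (edge_in n) A -> reflect (conn A u w) (connect (@adjl n A) u w).
Proof.
move=> /allP wfA; apply: (iffP idP) => [/connectP[p] | cA].
  elim: p u => [|x p ih] u /=; first by move=> _ -> s.
  case/andP=> ux px lx s sA; rewrite -(ih x px lx s sA).
  by case/orP: ux => /sA /=.
(* The separating colouring marks the vertices reachable from u; numbers outside the range get the
   default false. *)
pose s (z : nat) := if insub z is Some z' then connect (@adjl n A) u z' else false.
have sE (z : 'I_n) : s z = connect (@adjl n A) u z.
  by rewrite /s insubT //= => hz; congr (connect _ _); apply: val_inj.
have := cA s; rewrite !sE connect0 => <- // e eA.
have /andP[e1 e2] := wfA e eA.
have -> : e.1 = Ordinal e1 by []; have -> : e.2 = Ordinal e2 by [].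
rewrite !sE; apply: (same_connect_r (@adjl_sym n A)); apply: connect1.
by rewrite /adjl /= -surjective_pairing eA.
Qed.

Lemma eq_kl n A B : A =i B -> kl n A = kl n B.
Proof.
by move=> AB; rewrite !kl.unlock; apply: eq_n_comp; apply: eq_connect => u w; rewrite /adjl !AB.
Qed.

(** The closure of {u, w} is closed for both relations, which agree outside it. Inside it the new
    relation has one component, the old one has one or two. *)
Lemma kl_cons n A (u w : 'I_n) :
  kl n A = kl n ((u : nat, w : nat) :: A) + ~~ connect (@adjl n A) u w.
Proof.
set e := @adjl n A; set e' := @adjl n ((u : nat, w : nat) :: A).
have se : connect_sym e := @adjl_sym n A.
have se' : connect_sym e' := @adjl_sym n _.
have e'E x y : e' x y = [|| e x y, (x == u) && (y == w) | (y == u) && (x == w)].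
  rewrite /e' /e /adjl !inE !xpair_eqE -!val_eqE.
  by do 4!case: (_ == _ :> nat); rewrite /= ?orbT ?orbF.
have sub : subrel (connect e) (connect e').
  by apply: connect_sub => x y exy; apply: connect1; rewrite e'E exy.
pose a := closure e (pred2 u w).
have ua : u \in a by apply: mem_closure; rewrite !inE eqxx.
have wa : w \in a by apply: mem_closure; rewrite !inE eqxx orbT.
have cla : closed e a by apply: closure_closed.
have cla' : closed e' a.
  move=> x y; rewrite e'E => /or3P[/cla // | /andP[/eqP-> /eqP->] | /andP[/eqP-> /eqP->]].
    by rewrite ua wa.
  by rewrite ua wa.
have uw' : connect e' u w by apply: connect1; rewrite e'E !eqxx orbT.
have n1 : n_comp e' a = 1.
  rewrite -(n_comp_connect se' u); apply: eq_n_comp_r => x.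
  apply/idP/idP => [/existsP[y /andP[]] | /(closed_connect cla') <- //].
  move=> /sub xy /pred2P[] yE; rewrite yE in xy; rewrite inE se' //.
  by apply: connect_trans xy _; rewrite se'.
rewrite !kl.unlock (n_compC a e) (n_compC a e') -/e -/e' n1 n_comp_closure2 //.
have -> : n_comp e [predC a] = n_comp e' [predC a].
  rewrite (adjunction_n_comp id se se') //; first exact: predC_closed.
  apply: strict_adjunction => //; first exact: predC_closed.
    by apply/subsetP=> x _; apply/codomP; exists x.
  move=> x y /=; rewrite !inE negbK => xa; rewrite e'E.
  have xu : x != u by apply: contra xa => /eqP->.
  have xw : x != w by apply: contra xa => /eqP->.
  by rewrite (negPf xu) (negPf xw) andbF /= orbF.
lia.
Qed.

Lemma kl_conn n A u w : all (edge_in n) A -> u < n -> w < n ->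
  conn A u w -> kl n ((u, w) :: A) = kl n A.
Proof.
move=> wfA un wn cA; have := kl_cons A (Ordinal un) (Ordinal wn).
by rewrite (introT (connP (Ordinal un) (Ordinal wn) wfA) cA) addn0.
Qed.

Lemma kl_bridge n A u w : all (edge_in n) A -> u < n -> w < n ->
  ~ conn A u w -> kl n A = (kl n ((u, w) :: A)).+1.
Proof.
move=> wfA un wn cA; have := kl_cons A (Ordinal un) (Ordinal wn).
by rewrite (introF (connP (Ordinal un) (Ordinal wn) wfA) cA) addn1.
Qed.

Lemma kl_isolated n A : all (edge_in n) A -> kl n.+1 A = (kl n A).+1.
Proof.
move=> /allP wfA; set e := @adjl n.+1 A; set e' := @adjl n A.
have se : connect_sym e := @adjl_sym n.+1 A.
have se' : connect_sym e' := @adjl_sym n A.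
have iso x : e ord_max x = false.
  by apply/negP=> /orP[] /wfA; rewrite /edge_in /= ltnn ?andbF.
have cl : closed e (pred1 (@ord_max n)).
  apply: (intro_closed se) => x y exy /eqP xE; move: exy; rewrite xE iso //.
have E1 : n_comp e (pred1 (@ord_max n)) = 1.
  rewrite -(n_comp_connect se ord_max); apply: eq_n_comp_r => x.
  apply/idP/idP => [/eqP-> | /(closed_connect cl) <-]; last exact: eqxx.
  by rewrite inE connect0.
rewrite !kl.unlock (n_compC (pred1 (@ord_max n)) e) E1 add1n; congr _.+1.
rewrite (adjunction_n_comp (widen_ord (leqnSn n)) se se'); last 1 first.
- apply: strict_adjunction => //; first exact: predC_closed.
  + by move=> x y /(congr1 val) /= xy; apply: val_inj.
  + apply/subsetP=> x; rewrite !inE => xm; apply/codomP.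
    have xn : x < n.
      by have := ltn_ord x; rewrite ltnS leq_eqVlt => /orP[xE|//]; case/negP: xm.
    by exists (Ordinal xn); apply: val_inj.
- apply: eq_n_comp_r => x; rewrite !inE -val_eqE /=.
  by have := ltn_ord x; rewrite neq_ltn => ->.
- exact: predC_closed.
Qed.

(** These are the cases with one or both halves of the subdivided edge present; with neither,
    [kl_isolated] applies. *)
Lemma kl_subdivide n A u w : all (edge_in n) A -> u < n -> w < n ->
  [/\ kl n.+1 (rcons A (u, n)) = kl n A, kl n.+1 (rcons A (n, w)) = kl n A &
      kl n.+1 (rcons (rcons A (n, w)) (u, n)) = kl n (rcons A (u, w))].
Proof.
move=> wfA un wn.
have rE (B : seq (nat * nat)) e m : kl m (rcons B e) = kl m (e :: B).
  by apply: eq_kl => x; rewrite mem_rcons.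
have wfA1 : all (edge_in n.+1) A.
  by apply: sub_all wfA => e; rewrite /edge_in => /andP[? ?]; apply/andP; split; lia.
have lone (B : seq (nat * nat)) x : all (edge_in n) B -> x < n -> ~ conn B x n /\ ~ conn B n x.
  move=> /allP wfB xn.
  have sB e : e \in B -> (e.1 < n) = (e.2 < n) by move/wfB/andP=> [-> ->].
  by split=> /(_ (fun z => z < n) sB); rewrite ltnn xn.
have iso := kl_isolated wfA.
have k1 : kl n.+1 ((u, n) :: A) = kl n A.
  have := @kl_bridge n.+1 A u n wfA1 (ltnW un) (ltnSn n) (proj1 (lone _ _ wfA un)).
  by rewrite iso => -[].
have k2 : kl n.+1 ((n, w) :: A) = kl n A.
  have := @kl_bridge n.+1 A n w wfA1 (ltnSn n) (ltnW wn) (proj2 (lone _ _ wfA wn)).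
  by rewrite iso => -[].
split; rewrite !rE //.
have -> : kl n.+1 ((u, n) :: rcons A (n, w)) = kl n.+1 ((u, n) :: (n, w) :: A).
  by apply: eq_kl => x; rewrite !inE mem_rcons inE.
have wf2 : all (edge_in n.+1) ((n, w) :: A).
  by rewrite /= wfA1 andbT /edge_in /=; lia.
have h1 := @kl_conn n.+1 ((n, w) :: A) u n wf2 (ltnW un) (ltnSn n).
have h2 := @kl_bridge n.+1 ((n, w) :: A) u n wf2 (ltnW un) (ltnSn n).
case: (connP (Ordinal un) (Ordinal wn) wfA) => cA /=.
  rewrite h1 ?k2 ?kl_conn // => s sB.
  rewrite (cA s) => [|e eA]; last by apply: sB; rewrite inE eA orbT.
  by rewrite -(sB (n, w)) // inE eqxx.
suff cB : ~ conn ((n, w) :: A) u n.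
  by have := h2 cB; rewrite k2 (kl_bridge wfA un wn cA) => -[].
move=> cB; apply: cA => s sA /=.
(* Extend the colouring to the new vertex by the colour of w, its only neighbour so far. *)
have := cB (fun x => if x == n then s w else s x).
rewrite eqxx (ltn_eqF un) => -> // e; rewrite inE => /orP[/eqP->|eA] /=.
  by rewrite eqxx (ltn_eqF wn).
have /andP[e1 e2] := allP wfA e eA.
by rewrite (ltn_eqF e1) (ltn_eqF e2); apply: sA.
Qed.

Definition relabels (f : nat -> nat) (e e' : nat * nat) : bool :=
  (e' == (f e.1, f e.2)) || (e' == (f e.2, f e.1)).

(** [W] pairs each edge with its image under f, in either orientation; f is onto by counting. *)
Lemma kl_relabel n f (W : seq ((nat * nat) * (nat * nat))) :
  (forall x, x < n -> f x < n) ->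
  (forall x y, x < n -> y < n -> f x = f y -> x = y) ->
  all (edge_in n) (unzip1 W) -> all (fun p => relabels f p.1 p.2) W ->
  kl n (unzip2 W) = kl n (unzip1 W).
Proof.
move=> fn finj /allP wfW /allP rW.
pose h (x : 'I_n) := Ordinal (fn x (ltn_ord x)).
have hinj : injective h.
  by move=> x y /(congr1 val) /= /finj xy; apply: val_inj; apply: xy.
have adjE x y : adjl (unzip2 W) (h x) (h y) = adjl (unzip1 W) x y.
  apply/idP/idP.
    move=> H; have {H} [p pW] : exists2 p, p \in W & (p.2 == (f x, f y)) || (p.2 == (f y, f x)).
      by case/orP: H => /mapP[p pW pE]; exists p => //; rewrite -pE eqxx ?orbT.
    have pU : p.1 \in unzip1 W by apply: map_f.
    have /andP[p1 p2] := wfW _ pU.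
    have pq u w : u < n -> w < n -> (f p.1.1, f p.1.2) = (f u, f w) -> p.1 = (u, w).
      move=> un wn [/finj-/(_ p1 un) e1 /finj-/(_ p2 wn) e2].
      by rewrite (surjective_pairing p.1) e1 e2.
    rewrite /adjl; have := rW _ pW; rewrite /relabels.
    have [xn yn] := (ltn_ord x, ltn_ord y).
    case/orP=> /eqP-> /orP[] /eqP[E1 E2].
    - by rewrite -(pq x y) ?pU // E1 E2.
    - by rewrite -(pq y x) ?pU ?orbT // E1 E2.
    - by rewrite -(pq y x) ?pU ?orbT // E1 E2.
    - by rewrite -(pq x y) ?pU // E1 E2.
  move=> H; have {H} [p pW] : exists2 p, p \in W & (p.1 == (x : nat, y : nat)) || (p.1 == (y : nat, x : nat)).
    by case/orP: H => /mapP[p pW pE]; exists p => //; rewrite -pE eqxx ?orbT.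
  have pU : p.2 \in unzip2 W by apply: map_f.
  rewrite /adjl /=; have := rW _ pW; rewrite /relabels.
  by move=> /orP[] /eqP p2E /orP[] /eqP pE; rewrite p2E pE /= in pU; rewrite pU ?orbT.
have s1 := @adjl_sym n (unzip1 W); have s2 := @adjl_sym n (unzip2 W).
have cl : closed (@adjl n (unzip2 W)) 'I_n by [].
rewrite !kl.unlock (adjunction_n_comp h s2 s1 cl); first by apply: eq_n_comp_r.
apply: (strict_adjunction s1 cl hinj) => [|x y _]; last exact: adjE.
by apply/subsetP=> x _; apply: (inj_card_onto hinj); rewrite ?card_ord.
Qed.

Lemma perm_lift (S T : eqType) (f : S -> T) (s : seq S) (t : seq T) :
  perm_eq (map f s) t -> exists2 s', perm_eq s s' & map f s' = t.
Proof.
case: s => [|x0 s]; first by rewrite perm_sym => /perm_nilP->; exists [::].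
rewrite perm_sym => /(perm_iotaP (f x0))[Is IsP ->].
exists (map (nth x0 (x0 :: s)) Is).
  by rewrite perm_sym; apply/(perm_iotaP x0); exists Is; rewrite // size_map in IsP.
rewrite -map_comp; apply/eq_in_map => i.
by rewrite (perm_mem IsP) mem_iota size_map => /andP[_ iP]; rewrite [RHS](nth_map x0).
Qed.

(** * The partition function of a labelled edge list *)

(* Endpoints, a capacity (the flow the edge stands for), and the homogeneous
   weight [(a, b)]. *)
Definition ledge : Type := ((nat * nat) * (nat * (Cx * Cx)))%type.
Definition lends (x : ledge) := x.1.
Definition lcap (x : ledge) := x.2.1.
Definition la (x : ledge) := x.2.2.1.
Definition lb (x : ledge) := x.2.2.2.

(** [A] holds the edges already taken; each further edge contributes a when left out and b when
    taken. This is the homogeneous form of the partition function. *)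
Fixpoint Zl (q : Cx) (n : nat) (A : seq (nat * nat)) (s : seq ledge) : Cx :=
  match s with
  | [::] => Cpow q (kl n A)
  | x :: s' => Cadd (Cmul (la x) (Zl q n A s')) (Cmul (lb x) (Zl q n (lends x :: A) s'))
  end.

Lemma eq_Zl q n A B s : A =i B -> Zl q n A s = Zl q n B s.
Proof.
elim: s A B => [|x s ih] A B AB /=; first by rewrite (eq_kl _ AB).
by congr Cadd; congr Cmul; apply: ih => // y; rewrite !inE AB.
Qed.

Lemma Zl_cons_cat q n A x s t : Zl q n A (x :: s ++ t) = Zl q n A (s ++ x :: t).
Proof.
elim: s A => [|y s ih] A //=.
have := ih A; have := ih (lends y :: A); rewrite /= => <- <-.
have -> : Zl q n [:: lends y, lends x & A] (s ++ t) = Zl q n [:: lends x, lends y & A] (s ++ t).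
  by apply: eq_Zl => z; rewrite !inE orbCA.
ring.
Qed.

Lemma perm_Zl q n A s t : perm_eq s t -> Zl q n A s = Zl q n A t.
Proof.
elim: s A t => [|x s ih] A t; first by rewrite perm_sym => /perm_nilP->.
move=> st; have xt : x \in t by rewrite -(perm_mem st) mem_head.
case/splitPr: xt st => t1 t2 st; rewrite -Zl_cons_cat /=.
have {}st : perm_eq s (t1 ++ t2).
  by rewrite -(perm_cons x); apply: perm_trans st _; rewrite perm_catC /= perm_cons perm_catC.
by rewrite !(ih _ _ st).
Qed.

(** If replacing [P] by [P'] shifts every component count by d, it changes the partition function by
    the factor q^d. *)
Lemma Zl_shift q d m n P P' A (s : seq ledge) :
  (forall B, all (edge_in n) B -> kl m (B ++ P) = d + kl n (B ++ P')) ->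
  all (edge_in n) A -> all (edge_in n) (map lends s) ->
  Zl q m (A ++ P) s = Cmul (Cpow q d) (Zl q n (A ++ P') s).
Proof.
move=> dP; elim: s A => [|x s ih] A wfA /=; first by rewrite dP // CpowD.
case/andP=> xn sn; have := ih (lends x :: A); rewrite /= xn => -> //.
rewrite ih //; ring.
Qed.

Lemma Zl_relabel q n f (W : seq ((nat * nat) * (nat * nat))) (S : seq (ledge * ledge)) :
  (forall x, x < n -> f x < n) ->
  (forall x y, x < n -> y < n -> f x = f y -> x = y) ->
  all (edge_in n) (unzip1 W) -> all (fun p => relabels f p.1 p.2) W ->
  all (edge_in n) (map lends (unzip1 S)) ->
  all (fun p => relabels f (lends p.1) (lends p.2) && (p.1.2 == p.2.2)) S ->
  Zl q n (unzip2 W) (unzip2 S) = Zl q n (unzip1 W) (unzip1 S).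
Proof.
move=> fn finj; elim: S W => [|[x y] S ih] W wfW rW /=.
  by rewrite (kl_relabel fn finj).
case/andP=> xn Sn /andP[/andP[rxy /eqP xy] rS].
have := ih ((lends x, lends y) :: W); rewrite /= xn rxy /= => -> //.
by rewrite (ih W) // /la /lb xy.
Qed.

(** Taking neither half gives q a1 a2, taking exactly one gives a1 b2 + b1 a2; these sum to [ser_a].
    Taking both acts like the edge uw with coefficient b1 b2. *)
Lemma Zl_subdivide q n u w c1 c2 c a1 b1 a2 b2 (s : seq ledge) :
  all (edge_in n) (map lends s) -> u < n -> w < n ->
  Zl q n.+1 [::] (((u, n), (c1, (a1, b1))) :: ((n, w), (c2, (a2, b2))) :: s) =
  Zl q n [::] (((u, w), (c, (ser_a q a1 b1 a2 b2, Cmul b1 b2))) :: s).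
Proof.
move=> wfs un wn; rewrite /= /la /lb /lends /=.
have nil0 : all (edge_in n) [::] by [].
have k (B : seq (nat * nat)) (wfB : all (edge_in n) B) := kl_subdivide wfB un wn.
have := @Zl_shift q 1 n.+1 n [::] [::] [::] s _ nil0 wfs => /= -> ; last first.
  by move=> B wfB; rewrite !cats0 kl_isolated.
have := @Zl_shift q 0 n.+1 n [:: (u, n)] [::] [::] s _ nil0 wfs => /= -> ; last first.
  by move=> B wfB; rewrite !cats0 cats1; case: (k B wfB) => ->.
have := @Zl_shift q 0 n.+1 n [:: (n, w)] [::] [::] s _ nil0 wfs => /= -> ; last first.
  by move=> B wfB; rewrite !cats0 cats1; case: (k B wfB) => _ ->.
have := @Zl_shift q 0 n.+1 n [:: (n, w); (u, n)] [:: (u, w)] [::] s _ nil0 wfs => /= -> ; last first.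
  by move=> B wfB; rewrite !cats1 -cat_rcons cats1; case: (k B wfB) => _ _ ->.
rewrite /ser_a; ring.
Qed.

(** The component count is the same whether one copy or both are taken, so those three terms add up
    to [par_b]. *)
Lemma Zl_parallel q n e c1 c2 c a1 b1 a2 b2 (s : seq ledge) :
  Zl q n [::] ((e, (c1, (a1, b1))) :: (e, (c2, (a2, b2))) :: s) =
  Zl q n [::] ((e, (c, (Cmul a1 a2, par_b a1 b1 a2 b2))) :: s).
Proof.
rewrite /= /la /lb /lends /=.
have -> : Zl q n [:: e; e] s = Zl q n [:: e] s by apply: eq_Zl => z; rewrite !inE orbb.
rewrite /par_b; ring.
Qed.

(** Every edge of [l] is a bridge in the presence of [A]; the permutation brings an arbitrary edge
    to the front. *)
Definition acyclic (A l : seq (nat * nat)) : Prop :=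
  forall e l', perm_eq l (e :: l') -> ~ conn (A ++ l') e.1 e.2.

Lemma acyclic_cons A e l : acyclic A (e :: l) ->
  [/\ ~ conn A e.1 e.2, acyclic A l & acyclic (e :: A) l].
Proof.
move=> acyc; split; first move=> cA.
- apply: (acyc e l); first exact: perm_refl.
  by apply: conn_sub cA => y yA; rewrite mem_cat yA.
all: move=> f l' fl cc; apply: (acyc f (e :: l')).
- by rewrite -(perm_cons e) in fl; apply: perm_trans fl _; rewrite (perm_catCA [:: e] [:: f]).
- by apply: conn_sub cc => y; rewrite !mem_cat !inE => /orP[->|->] //; rewrite !orbT.
- by rewrite -(perm_cons e) in fl; apply: perm_trans fl _; rewrite (perm_catCA [:: e] [:: f]).
- by apply: conn_sub cc => y; rewrite !inE !mem_cat !inE orbCA.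
Qed.

Definition wprod (q : Cx) (s : seq ledge) : Cx :=
  foldr (fun x c => Cmul (wden q (la x) (lb x)) c) Cone s.

(** Each bridge contributes (q a + b)/q; the power of q on the left clears the denominators. *)
Lemma Zl_forest q n A (s : seq ledge) :
  all (edge_in n) A -> all (edge_in n) (map lends s) -> acyclic A (map lends s) ->
  Cmul (Cpow q (size s)) (Zl q n A s) = Cmul (wprod q s) (Cpow q (kl n A)).
Proof.
elim: s A => [|x s ih] A wfA //=.
case/andP=> xn sn /acyclic_cons[bridge ac1 ac2].
have /andP[x1 x2] := xn.
have kA : kl n A = (kl n (lends x :: A)).+1.
  by rewrite (kl_bridge wfA x1 x2 bridge) -surjective_pairing.
have e1 := ih _ wfA sn ac1.
have e2 : Cmul (Cpow q (size s)) (Zl q n (lends x :: A) s) =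
          Cmul (wprod q s) (Cpow q (kl n (lends x :: A))).
  by apply: ih => //=; rewrite xn.
transitivity (Cmul q (Cadd (Cmul (la x) (Cmul (Cpow q (size s)) (Zl q n A s)))
   (Cmul (lb x) (Cmul (Cpow q (size s)) (Zl q n (lends x :: A) s))))); first ring.
rewrite e1 e2 kA /= /wden; ring.
Qed.

Lemma Zl_forest_neq0 q n (s : seq ledge) :
  q <> Czero -> (forall x, x \in s -> wden q (la x) (lb x) <> Czero) ->
  all (edge_in n) (map lends s) -> acyclic [::] (map lends s) ->
  Zl q n [::] s <> Czero.
Proof.
move=> q0 D sn ac Z0; have := @Zl_forest q n [::] s isT sn ac; rewrite Z0.
have -> : Cmul (Cpow q (size s)) Czero = Czero by ring.
suff w0 : wprod q s <> Czero.
  by move/esym; apply: Cmul_neq0 => //; apply: Cpow_neq0.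
elim: s D {sn ac Z0} => [|x s ih] D /=; first by case=> h; lra.
apply: Cmul_neq0; first by apply: D; rewrite mem_head.
by apply: ih => y ys; apply: D; rewrite inE ys orbT.
Qed.

(** * The Tutte polynomial as the partition function of an edge list *)

HB.instance Definition _ := Monoid.isComLaw.Build Cx Czero Cadd
  (Radd_assoc Cx_ring) (Radd_comm Cx_ring) (Radd_0_l Cx_ring).

HB.instance Definition _ := Monoid.isComLaw.Build R R1 Rmult
  (fun x y z => esym (Rmult_assoc x y z)) Rmult_comm Rmult_1_l.

Definition real_ledge (G : graph) (v : nat -> R) (e : nat) : ledge :=
  (ends G e, (1, (Cone, RtoC (v e)))).

Lemma Zl_subsets (G : graph) q v (s : seq 'I_(ne G)) (B : seq (nat * nat)) : uniq s ->
  Zl q (nv G) B (map (fun e : 'I_(ne G) => real_ledge G v e) s) =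
  \big[Cadd/Czero]_(A : {set 'I_(ne G)} | A \subset s)
    Cmul (Cpow q (kl (nv G) ([seq ends G (nat_of_ord e) | e <- enum A] ++ B)))
         (RtoC (\big[Rmult/R1]_(e in A) v e)).
Proof.
elim: s B => [|x s ih] B /=.
  move=> _; rewrite (big_pred1 set0) => [|A]; last first.
    apply/subsetP/eqP => [A0|-> z]; last by rewrite inE.
    by apply/setP=> z; rewrite inE; apply/negP=> /A0.
  rewrite big_set0 enum_set0 /=; have -> : RtoC R1 = Cone by [].
  ring.
case/andP=> xs us; rewrite (bigID (fun A : {set 'I_(ne G)} => x \in A)) /= ih // ih //.
rewrite [RHS](Radd_comm Cx_ring); congr Cadd.
  rewrite /la /=; have mul1 z : Cmul Cone z = z by ring.
  rewrite mul1; apply: eq_bigl => A; apply/idP/andP.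
    move=> As; split; first by apply: subset_trans As _; apply/subsetP=> z zs; rewrite inE zs orbT.
    by apply: contra xs; apply: (subsetP As).
  case=> /subsetP As xA; apply/subsetP=> z zA; have := As z zA; rewrite inE => /orP[/eqP zx|//].
  by rewrite -zx zA in xA.
have Cmul_sum (z : Cx) : {morph Cmul z : x y / Cadd x y} by move=> ? ?; ring.
have Cmul_0 (z : Cx) : Cmul z Czero = Czero by ring.
rewrite (big_morph _ (Cmul_sum _) (Cmul_0 _)).
(* The subsets containing x correspond to those avoiding it by adding x. *)
rewrite [RHS](reindex_onto (fun A => x |: A) (fun A => A :\ x)) /=; last first.
  by move=> A /andP[_ xA]; rewrite setD1K.
have subx (A : {set 'I_(ne G)}) : A \subset s -> x \notin A.
  by move=> As; apply: contra xs; apply: (subsetP As).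
have cond (A : {set 'I_(ne G)}) :
    [&& x |: A \subset x :: s, x \in x |: A & (x |: A) :\ x == A] = (A \subset s).
  rewrite setU11 /=; apply/andP/idP => [[/subsetP As /eqP AE]|As].
    apply/subsetP=> z zA; have := As z; rewrite !inE zA orbT => /(_ isT) /orP[/eqP zx|//].
    by move: zA; rewrite -AE zx !inE eqxx.
  split; last by rewrite setU1K // subx.
  apply/subsetP=> z; rewrite !inE => /orP[->//|zA]; by rewrite (subsetP As z zA) orbT.
rewrite [RHS](eq_bigl (fun A : {set 'I_(ne G)} => A \subset s)) => [|A]; last first.
  by rewrite -cond andbA.
apply: eq_bigr => A As; rewrite big_setU1 ?subx //=.
have -> : kl (nv G) ([seq ends G (nat_of_ord e) | e <- enum A] ++ ends G x :: B) =
   kl (nv G) ([seq ends G (nat_of_ord e) | e <- enum (x |: A)] ++ B).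
  apply: eq_kl => z; rewrite !mem_cat inE orbCA orbA; congr orb.
  apply/idP/mapP => [/orP[/eqP->|/mapP[e eA ->]]|[e]].
  - by exists x; rewrite // mem_enum setU11.
  - by exists e; rewrite // mem_enum in_setU -(mem_enum A) eA orbT.
  rewrite mem_enum in_setU1 => /orP[/eqP-> ->|eA ->]; first by rewrite eqxx.
  by apply/orP; right; apply: map_f; rewrite mem_enum.
have -> (y z : R) : RtoC (Rmult y z) = Cmul (RtoC y) (RtoC z).
  by apply: Cx_eq => /=; rewrite ?R0E; ring.
have Cmul_CA (y z t : Cx) : Cmul y (Cmul z t) = Cmul z (Cmul y t) by ring.
exact: Cmul_CA.
Qed.

Lemma ncomp_kl (G : graph) (A : {set 'I_(ne G)}) :
  ncomp A = kl (nv G) [seq ends G (nat_of_ord e) | e <- enum A].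
Proof.
rewrite kl.unlock /ncomp; apply: eq_n_comp; apply: eq_connect => u w.
rewrite /adjA /adjl /joins; apply/existsP/orP => [[e /andP[eA]]|].
  case/orP=> /andP[/eqP e1 /eqP e2]; [left|right]; rewrite -e1 -e2 -surjective_pairing;
    by apply: map_f; rewrite mem_enum.
by case=> /mapP[e]; rewrite mem_enum => eA eE; exists e; rewrite eA -eE /= !eqxx ?orbT.
Qed.

Lemma Ztutte_Zl (G : graph) q v :
  Ztutte G q v = Zl q (nv G) [::] (map (real_ledge G v) (iota 0 (ne G))).
Proof.
rewrite -val_enum_ord -map_comp Zl_subsets ?enum_uniq // /Ztutte.
apply: eq_big => [A|A _]; last by rewrite cats0 ncomp_kl.
by apply/esym/subsetP=> e _; rewrite mem_enum.
Qed.

(** * Integer flows and cuts *)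

Section Flows.
Variable G : graph.
Local Notation m := (ne G).
Local Notation n := (nv G).

Definition divergence (h : nat -> int) (z : nat) : int :=
  (\sum_(e < m) h e * (((ends G e).1 == z)%:Z - ((ends G e).2 == z)%:Z))%R.

(* [P (e, true)], resp. [P (e, false)], allows crossing [e] forwards, resp.
   backwards, relative to its stored orientation. *)
Definition darc (P : pred (nat * bool)) : rel 'I_n := fun a b =>
  [exists e : 'I_m, P (e : nat, true) && (ends G e == (a : nat, b : nat))
                 || P (e : nat, false) && (ends G e == (b : nat, a : nat))].

Lemma divergence_set (h h' : nat -> int) (e : nat) z : e < m ->
  (forall k, k != e -> h k = h' k) -> h' e = 0%R ->
  divergence h z =
    (divergence h' z + h e * (((ends G e).1 == z)%:Z - ((ends G e).2 == z)%:Z))%R.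
Proof.
move=> em hh' h'e; rewrite /divergence.
rewrite (bigD1 (Ordinal em)) //= [in RHS](bigD1 (Ordinal em)) //= h'e.
rewrite GRing.mul0r GRing.add0r GRing.addrC; congr (_ + _)%R.
apply: eq_bigr => k kN; rewrite hh' //.
Qed.

(** The clause placing the ends of flow-carrying edges among the visited vertices drives the
    induction: the first vertex is new, so the first edge carries no flow yet. *)
Lemma path_flow (P : pred (nat * bool)) (x : 'I_n) (p : seq 'I_n) :
  path (darc P) x p -> uniq (x :: p) ->
  exists (es : seq nat) (h : nat -> int),
  [/\ size es = size p,
      forall i, i < size es ->
        joins G (nth 0 es i) (nth (x : nat) (map val (x :: p)) i) (nth (x : nat) (map val p) i),
      forall e, e \in es -> e < m /\ h e <> 0%R,
      forall e, h e = 0%R \/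
        [/\ h e = 1%R /\ P (e, true) \/ h e = (-1)%R /\ P (e, false), e < m,
            (ends G e).1 \in map val (x :: p) & (ends G e).2 \in map val (x :: p)] &
      forall z, divergence h z = ((z == x)%:Z - (z == last x p)%:Z)%R].
Proof.
elim: p x => [|y p ih] x.
  move=> _ _; exists [::], (fun=> 0%R); split=> //; first by left.
  by move=> z; rewrite /divergence big1 /= => [|i _]; lia.
rewrite /= => /andP[/existsP[e exy] yp] /andP[xyp uyp].
have [es [h [szes jo es0 hP dh]]] := ih y yp uyp.
pose s : int := if P (e : nat, true) && (ends G e == (x : nat, y : nat)) then 1%R else (-1)%R.
have sP : (s = 1%R /\ P (e : nat, true) /\ ends G e = (x : nat, y : nat)) \/
          (s = (-1)%R /\ P (e : nat, false) /\ ends G e = (y : nat, x : nat)).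
  rewrite /s; case: ifP => c; first by left; case/andP: c => ? /eqP.
  by right; move: exy; rewrite c => /andP[? /eqP].
have xN : (x : nat) \notin map val (y :: p) by rewrite mem_map //; apply: val_inj.
have he : h e = 0%R.
  case: (hP e) => // -[_ _ e1 e2]; case: sP => -[_ [_ eE]]; case/negP: xN.
    by rewrite eE in e1.
  by rewrite eE in e2.
exists ((e : nat) :: es), (fun k : nat => if k == e :> nat then s else h k); split.
- by rewrite /= szes.
- case=> [_|i iP] /=.
    by rewrite /joins; case: sP => -[_ [_ ->]]; rewrite !eqxx ?orbT.
  have := jo i iP; rewrite /= in iP *.
  rewrite (set_nth_default (x : nat) (y : nat)) /= ?size_map -?szes; last lia.
  by rewrite (set_nth_default (x : nat) (y : nat)) /= ?size_map -?szes.
- move=> k; rewrite inE; case: eqP => [-> _|kN /= /es0 //].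
  by split; [exact: ltn_ord | case: sP => -[-> _]].
- move=> k; case: eqP => [->|kN].
    right; split; first by case: sP => -[-> [? _]]; [left|right].
    + exact: ltn_ord.
    + by case: sP => -[_ [_ ->]] /=; rewrite !inE eqxx ?orbT.
    + by case: sP => -[_ [_ ->]] /=; rewrite !inE eqxx ?orbT.
  case: (hP k) => [|[? ? e1 e2]]; [by left | right; split=> //].
    by rewrite /= inE; apply/orP; right.
  by rewrite /= inE; apply/orP; right.
- move=> z; rewrite (@divergence_set _ h e) //; last by move=> k /negPf->.
  rewrite dh eqxx /=.
  case: sP => -[-> [_ ->]] /=; rewrite (eq_sym _ z) [in X in (_ * (_ - X))%R](eq_sym _ z); lia.
Qed.

Lemma connect_flow (P : pred (nat * bool)) (x y : 'I_n) :
  connect (darc P) x y ->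
  exists (es : seq nat) (h : nat -> int),
  [/\ is_path G x y es, forall e, e \in es -> h e <> 0%R,
      forall e, h e = 0%R \/ e < m /\
        (h e = 1%R /\ P (e, true) \/ h e = (-1)%R /\ P (e, false)) &
      forall z, divergence h z = ((z == x)%:Z - (z == y)%:Z)%R].
Proof.
case/connectP=> p0 /shortenP[p xp up _] ->.
have [es [h [szes jo es0 hP dh]]] := path_flow xp up.
exists es, h; split=> //.
- split; first by apply/allP=> e /es0[].
  exists (map val p); split.
  + by rewrite size_map.
  + by rewrite -map_cons map_inj_uniq //; apply: val_inj.
  + by rewrite last_map.
  + by move=> i ip; apply: jo.
- by move=> e /es0[].
- by move=> e; case: (hP e) => [|[]]; [left|right].
Qed.

Lemma connect_cut (P : pred (nat * bool)) (x y : 'I_n) :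
  wf_graph G -> ~~ connect (darc P) x y ->
  exists S : nat -> bool,
  [/\ S x, ~~ S y,
      forall e, e < m -> S (ends G e).1 -> ~~ S (ends G e).2 -> ~~ P (e, true) &
      forall e, e < m -> ~~ S (ends G e).1 -> S (ends G e).2 -> ~~ P (e, false)].
Proof.
move=> wf xy.
pose S (z : nat) := if insub z is Some z' then connect (darc P) x z' else false.
have SE (z : 'I_n) : S z = connect (darc P) x z.
  by rewrite /S insubT //= => hz; congr (connect _ _); apply: val_inj.
exists S; rewrite !SE connect0; split=> // e em; have [e1 e2] := wf e em;
  have -> : (ends G e).1 = Ordinal e1 by []; have -> : (ends G e).2 = Ordinal e2 by [];
  rewrite !SE => c1 c2; apply/negP => Pe.
- case/negP: c2; apply: connect_trans c1 (connect1 _); apply/existsP; exists (Ordinal em).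
  by rewrite Pe /= -surjective_pairing eqxx.
- case/negP: c1; apply: connect_trans c2 (connect1 _); apply/existsP; exists (Ordinal em).
  by rewrite Pe /= -surjective_pairing eqxx orbT.
Qed.

Lemma cut_divergence (h : nat -> int) (S : nat -> bool) : wf_graph G ->
  (\sum_(z < n | S z) divergence h z =
   \sum_(e < m) h e * ((S (ends G e).1)%:Z - (S (ends G e).2)%:Z))%R.
Proof.
move=> wf; rewrite exchange_big /=; apply: eq_bigr => e _.
rewrite -GRing.mulr_sumr GRing.sumrB; congr (_ * (_ - _))%R.
  have [e1 _] := wf e (ltn_ord e).
  case: (boolP (S (ends G e).1)) => Se.
    rewrite (bigD1 (Ordinal e1)) //= eqxx big1 ?GRing.addr0 // => z /andP[_ zN].
    by rewrite eq_sym -[(ends G e).1]/(val (Ordinal e1)) val_eqE (negPf zN).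
  by rewrite big1 // => z Sz; case: eqP => // zE; rewrite -zE (negPf Se) in Sz.
have [_ e2] := wf e (ltn_ord e).
case: (boolP (S (ends G e).2)) => Se.
  rewrite (bigD1 (Ordinal e2)) //= eqxx big1 ?GRing.addr0 // => z /andP[_ zN].
  by rewrite eq_sym -[(ends G e).2]/(val (Ordinal e2)) val_eqE (negPf zN).
by rewrite big1 // => z Sz; case: eqP => // zE; rewrite -zE (negPf Se) in Sz.
Qed.

(** [k] is the value of the flow; unit refers to the edge capacities. *)
Definition unit_flow (k : nat) (x y : nat) (f : nat -> int) : Prop :=
  (forall e, (-1 <= f e)%R /\ (f e <= 1)%R) /\
  forall z, divergence f z = (k%:Z * ((z == x)%:Z - (z == y)%:Z))%R.

Lemma unit_flow_cut k (x y : 'I_n) f (S : nat -> bool) :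
  wf_graph G -> unit_flow k x y f -> S x -> ~~ S y ->
  (\sum_(e < m) f e * ((S (ends G e).1)%:Z - (S (ends G e).2)%:Z))%R = Posz k.
Proof.
move=> wf [_ df] Sx Sy; rewrite -cut_divergence //.
rewrite (eq_bigr _ (fun (z : 'I_n) _ => df z)) (bigD1 x) //= eqxx.
have xy : (x == y :> nat) = false by apply/eqP=> xy; move: Sy; rewrite -xy Sx.
rewrite xy big1; first by lia.
move=> z /andP[Sz zx]; have -> : (z == x :> nat) = false by apply/negbTE.
have -> : (z == y :> nat) = false by apply/eqP=> zy; move: Sy; rewrite -zy Sz.
lia.
Qed.

Lemma divergenceD (f h : nat -> int) (s : int) z :
  divergence (fun e => f e + s * h e)%R z = (divergence f z + s * divergence h z)%R.
Proof.
rewrite /divergence GRing.mulr_sumr -big_split /=; apply: eq_bigr => e _.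
by rewrite GRing.mulrDl GRing.mulrA.
Qed.

(** Peel off a path along arcs carrying flow in their direction. If y were unreachable by such arcs,
    the cut of reachable vertices would have nonpositive outflow, against the positive value. *)
Lemma flow_decomposition k (x y : 'I_n) f : wf_graph G -> unit_flow k x y f ->
  exists P : seq (seq nat),
  [/\ size P = k, forall p, p \in P -> is_path G x y p, edge_disjoint P &
      forall p e, p \in P -> e \in p -> f e <> 0%R].
Proof.
move=> wf; elim: k f => [|k ih] f flf.
  by exists [::]; split=> // i j; rewrite ltn0.
have [fb df] := flf.
pose D : pred (nat * bool) := fun eb => f eb.1 == (if eb.2 then 1%R else (-1)%R).
case: (boolP (connect (darc D) x y)) => [/connect_flow[p [h [pxy ph hD dh]]]|]; last first.
  move/(connect_cut wf)=> [S [Sx Sy S1 S2]].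
  have := unit_flow_cut wf flf Sx Sy.
  have : (\sum_(e < m) f e * ((S (ends G e).1)%:Z - (S (ends G e).2)%:Z) <= 0)%R.
    apply: Num.Theory.sumr_le0 => e _; have := S1 e (ltn_ord e); have := S2 e (ltn_ord e).
    have := fb e; rewrite /D /=.
    by case: (S _); case: (S _) => //= fbe H2 H1; try have := H1 isT isT; try have := H2 isT isT; lia.
  lia.
have flf' : unit_flow k x y (fun e => f e + (-1) * h e)%R.
  split=> [e|z]; last by rewrite divergenceD df dh; lia.
  have := fb e; case: (hD e) => [->|[_]]; rewrite /D /=; lia.
have [P [szP Pp dP fP]] := ih _ flf'.
(* Edges of the peeled path carry no flow afterwards, so later paths avoid them. *)
have fh e : e \in p -> (f e + (-1) * h e)%R = 0%R /\ f e <> 0%R.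
  by move=> ep; have := ph e ep; case: (hD e) => [->|[_]]; rewrite /D /=; lia.
exists (p :: P); split.
- by rewrite /= szP.
- by move=> r; rewrite inE => /orP[/eqP->|/Pp].
- move=> [|i] [|j] //= iP jP ij e ei; apply/negP=> ej.
  + by apply: (fP _ e (mem_nth _ jP) ej); case: (fh _ ei).
  + by apply: (fP _ e (mem_nth _ iP) ei); case: (fh _ ej).
  + by have := dP i j iP jP _ e ei; rewrite ej => H; have := H (fun ije => ij (congr1 S ije)).
- move=> r e; rewrite inE => /orP[/eqP-> /fh[]//|rP er].
  have := fP r e rP er; have := hD e; rewrite /D /=; lia.
Qed.

(** Augment the zero flow. Value L + 1 would decompose into L + 1 disjoint paths, so augmentation
    fails at some k <= L; the cut then found is saturated and has exactly k edges. *)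
Lemma menger (L x y : nat) : wf_graph G -> x < n -> y < n -> x <> y -> lambda_le G x y L ->
  exists S : nat -> bool, S x != S y /\
    \sum_(e < m) (S (ends G e).1 != S (ends G e).2) <= L.
Proof.
move=> wf xn yn xy lam.
have xE : x = Ordinal xn by []; have yE : y = Ordinal yn by [].
suff main d k f : k + d = L.+1 -> unit_flow k x y f -> exists S : nat -> bool, S x != S y /\
    \sum_(e < m) (S (ends G e).1 != S (ends G e).2) <= L.
  apply: (main L.+1 0 (fun=> 0%R)) => //; split=> [e|z]; first by lia.
  by rewrite /divergence big1 => [|i _]; lia.
elim: d k f => [|d ih] k f kd flf.
  rewrite xE yE in flf.
  have [P [szP Pp dP _]] := flow_decomposition wf flf.
  by have := lam P Pp dP; lia.
(* [D] consists of the residual arcs: forwards where f <= 0, backwards where f >= 0. *)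
have [fb df] := flf.
pose D : pred (nat * bool) := fun eb => if eb.2 then (f eb.1 <= 0)%R else (0 <= f eb.1)%R.
case: (boolP (connect (darc D) (Ordinal xn) (Ordinal yn))) => [/connect_flow[p [h [pxy ph hD dh]]]|].
  apply: (ih k.+1 (fun e => f e + 1 * h e)%R); first by lia.
  split=> [e|z]; last by rewrite divergenceD df dh /=; lia.
  by have := fb e; case: (hD e) => [->|[_]]; rewrite /D /=; lia.
move/(connect_cut wf)=> [S [Sx Sy S1 S2]]; exists S; split.
  by rewrite xE yE Sx (negPf Sy).
have := @unit_flow_cut k (Ordinal xn) (Ordinal yn) f S wf flf Sx Sy.
suff -> : (\sum_(e < m) f e * ((S (ends G e).1)%:Z - (S (ends G e).2)%:Z) =
   (\sum_(e < m) (S (ends G e).1 != S (ends G e).2))%:Z)%R by lia.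
rewrite (big_morph Posz PoszD (erefl _)); apply: eq_bigr => e _.
have := S1 e (ltn_ord e); have := S2 e (ltn_ord e); have := fb e; rewrite /D /=.
by case: (S _); case: (S _) => //= fbe H2 H1; try have := H1 isT isT; try have := H2 isT isT; lia.
Qed.

(** [connect_flow] serves to produce a path avoiding the edge; without one, the reachable set is a
    colouring contradicting connectedness. *)
Lemma forest_acyclic : forest G -> acyclic [::] (es G).
Proof.
case=> wf nocyc e l el; rewrite cat0s => cl; apply: nocyc.
have eG : e \in es G by rewrite (perm_mem el) mem_head.
pose i := index e (es G).
have im : i < m by rewrite /ne index_mem.
have ei : ends G i = e by rewrite /ends nth_index.
exists i; split=> //; right.
have [e1 e2] := wf i im.
pose D : pred (nat * bool) := fun eb => eb.1 != i.
case: (boolP (connect (darc D) (Ordinal e1) (Ordinal e2))) => [/connect_flow[p [h [pxy ph hD _]]]|].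
  exists p; split=> //; apply/negP => ip; have := ph i ip.
  by case: (hD i) => // -[_]; rewrite /D /= eqxx => -[] [].
move/(connect_cut wf)=> [S [/= Sx Sy S1 S2]].
suff sl : forall d, d \in l -> S d.1 = S d.2.
  by have := cl S sl; rewrite -ei Sx (negPf Sy).
move=> d dl.
have {dl} [j jm [ji jd]] : exists2 j, j < m & j != i /\ ends G j = d.
  have lrem : perm_eq l (rem e (es G)).
    by rewrite -(perm_cons e) perm_sym; apply: perm_trans el; rewrite perm_sym perm_to_rem.
  move: dl; rewrite (perm_mem lrem) remE -/i mem_cat => /orP[] /(nthP (0, 0))[j].
    rewrite size_take_min leq_min => /andP[ji jm] <-; exists j; rewrite ?neq_ltn ?ji // /ends nth_take //.
  rewrite size_drop => jm <-; exists (i.+1 + j); first by rewrite /ne -ltn_subRL.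
  by rewrite nth_drop; split=> //; rewrite neq_ltn addSn ltnS leq_addr orbT.
have := S1 j jm; have := S2 j jm; rewrite /D /= ji jd.
by case: (S _); case: (S _) => //= H1 H2; [have := H2 isT isT | have := H1 isT isT].
Qed.

End Flows.

(** * Series-parallel reduction *)

(** Operations act at the front of the list; [sp_perm] brings any edge there, which avoids
    indices. *)
Inductive sp : nat -> seq (nat * nat) -> Prop :=
| sp_forest n l : all (edge_in n) l -> acyclic [::] l -> sp n l
| sp_subdivide n u w l : sp n ((u, w) :: l) -> sp n.+1 ((u, n) :: (n, w) :: l)
| sp_double n e l : sp n (e :: l) -> sp n (e :: e :: l)
| sp_perm n l l' : perm_eq l l' -> sp n l -> sp n l'
| sp_relabel n f (W : seq ((nat * nat) * (nat * nat))) :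
    (forall x, x < n -> f x < n) ->
    (forall x y, x < n -> y < n -> f x = f y -> x = y) ->
    all (fun p => relabels f p.1 p.2) W ->
    sp n (unzip1 W) -> sp n (unzip2 W).

Lemma sp_edges n l : sp n l ->
  all (edge_in n) l /\ all (fun e : nat * nat => e.1 != e.2) l.
Proof.
elim=> {n l} [n l wfl ac|n u w l _ []|n e l _ []|n l l' ll' _ []|n f W fn finj rW _ []].
- split=> //; apply/allP=> e el; apply/eqP=> ee.
  by apply: (ac e (rem e l) (perm_to_rem el)) => S _; rewrite ee.
- rewrite /edge_in /= => /andP[/andP[un wn] wfl] /andP[_ ll]; split; last first.
    by rewrite (ltn_eqF un) (gtn_eqF wn).
  have [u1 w1] : u < n.+1 /\ w < n.+1 by split; apply: ltnW.
  rewrite u1 w1 ltnSn /=.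
  by apply: sub_all wfl => e /andP[? ?]; apply/andP; split; lia.
- by move=> /= /andP[-> ->] /andP[-> ->].
- by rewrite !(perm_all _ ll').
- move=> wfW lW; split; apply/allP => e /mapP[p pW ->];
    have /andP[p1 p2] := allP wfW _ (map_f fst pW);
    have /eqP pN := allP lW _ (map_f fst pW);
    have /orP[] := allP rW _ pW => /eqP-> /=; rewrite /edge_in /= ?fn //;
    by apply/eqP=> /finj pp; apply: pN; rewrite pp.
Qed.

Lemma perm_nth_front (T : eqType) (x0 : T) (s : seq T) i : i < size s ->
  perm_eq s (nth x0 s i :: take i s ++ drop i.+1 s).
Proof.
move=> im; rewrite -{1}(cat_take_drop i s) (drop_nth x0) //.
by apply/permP => P; rewrite /= !count_cat /= addnCA.
Qed.

Lemma sp_graph (G : graph) : series_parallel G -> sp (nv G) (es G).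
Proof.
elim=> {G} [G fG|G i _ sG im|G i _ sG im|G H _ sG [nGH [mGH [f [p [fn finj pm pinj rGH]]]]]].
- apply: sp_forest (forest_acyclic fG).
  by case: fG => wf _; apply/(all_nthP (0, 0)) => i im; apply/andP; apply: wf.
- have sG' : sp (nv G) (((ends G i).1, (ends G i).2) :: take i (es G) ++ drop i.+1 (es G)).
    by rewrite -surjective_pairing; apply: sp_perm sG; apply: perm_nth_front.
  apply: sp_perm (sp_subdivide sG'); rewrite /= set_nthE; move: im; rewrite /ne => ->.
  by rewrite perm_sym perm_rcons; apply/permP => P; rewrite /= !count_cat /=; lia.
- have sG' : sp (nv G) (ends G i :: take i (es G) ++ drop i.+1 (es G)).
    by apply: sp_perm sG; apply: perm_nth_front.
  apply: sp_perm (sp_double sG'); rewrite /= perm_sym perm_rcons perm_cons.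
  exact: perm_nth_front.
- pose W := [seq (ends G (p j), ends H j) | j <- iota 0 (ne G)].
  have W2 : unzip2 W = es H by rewrite /unzip2 -map_comp mGH; apply: mkseq_nth.
  have W1 : perm_eq (es G) (unzip1 W).
    rewrite /unzip1 -map_comp -{1}(mkseq_nth (0, 0) (es G)) /mkseq -/(ne G).
    rewrite (map_comp (ends G) p); apply: perm_map; rewrite perm_sym.
    (* An injection of the finite index set into itself is a permutation. *)
    have up : uniq (map p (iota 0 (ne G))).
      rewrite map_inj_in_uniq ?iota_uniq // => j k; rewrite !mem_iota; exact: pinj.
    have sub : {subset map p (iota 0 (ne G)) <= iota 0 (ne G)}.
      by move=> x /mapP[j]; rewrite mem_iota => jm ->; rewrite mem_iota; apply: pm.
    have le : size (iota 0 (ne G)) <= size (map p (iota 0 (ne G))) by rewrite size_map.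
    have pE := (uniq_min_size up sub le).2.
    by apply: uniq_perm; rewrite ?iota_uniq.
  rewrite -nGH -W2; apply: (sp_relabel (f := f)) => //; last exact: sp_perm sG.
  apply/allP=> x /mapP[j]; rewrite mem_iota => jm -> /=; rewrite /relabels.
  by have [->|->] := rGH j jm; rewrite eqxx ?orbT.
Qed.

(** * The invariant carried through the reductions *)

Definition crossing (S : nat -> bool) (x : ledge) : bool :=
  S (lends x).1 != S (lends x).2.

Lemma crossing_gt0 (S : nat -> bool) u w (s : seq ledge) :
  conn (map lends s) u w -> S u != S w -> (forall x, x \in s -> 0 < lcap x) ->
  0 < \sum_(x <- s | crossing S x) lcap x.
Proof.
move=> cs Suw s0; rewrite lt0n; apply: contra Suw; rewrite sum_nat_seq_eq0 => /allP h.
apply/eqP/cs => e /mapP[x xs ->]; apply/eqP; have := h x xs; rewrite /crossing.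
by have := s0 x xs; case: (lcap x) => // k _; rewrite implybF negbK.
Qed.

Section Induction.
Variables (q : Cx) (L : nat).
Let Q := Cmod (Csub q Cone).
Hypothesis Q1 : (1 < Q)%real.
Hypothesis QL : forall c, 0 < c -> c < L -> (growth Q ^ c <= 2 * Q / (Q + 1))%real.

(** The class bound is required only of edges on a cycle: a bridge may have capacity [L], beyond the
    reach of [QL], and needs just a nonzero denominator. *)
Definition admissible (n : nat) (s : seq ledge) : Prop :=
  [/\ forall x, x \in s -> 0 < lcap x /\ wden q (la x) (lb x) <> Czero,
      forall x t, perm_eq s (x :: t) -> conn (map lends t) (lends x).1 (lends x).2 ->
        wclass q (lcap x) (la x) (lb x) &
      forall x y, x < n -> y < n -> x <> y ->
        exists S : nat -> bool, S x != S y /\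
          \sum_(e <- s | crossing S e) lcap e <= L].

Lemma admissible_perm n s t : perm_eq s t -> admissible n s -> admissible n t.
Proof.
move=> st [h1 h2 h3]; split.
- by move=> x; rewrite -(perm_mem st); apply: h1.
- by move=> x r /(perm_trans st); apply: h2.
- move=> x y xn yn xy; have [S [Sxy cS]] := h3 x y xn yn xy.
  by exists S; rewrite -(perm_big _ st).
Qed.

(** A cut of capacity at most L between the ends of x contains x and, as the ends stay connected
    without x, another edge of positive capacity. *)
Lemma cap_lt n x s : admissible n (x :: s) -> edge_in n (lends x) ->
  (lends x).1 != (lends x).2 ->
  conn (map lends s) (lends x).1 (lends x).2 -> lcap x < L.
Proof.
move=> [h1 _ h3] /andP[x1 x2] /eqP xN cs.
have [S [Sx cS]] := h3 _ _ x1 x2 xN.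
apply: leq_trans cS; rewrite big_cons /crossing Sx.
rewrite -addn1 leq_add2l; apply: (crossing_gt0 cs Sx) => y ys.
by have [] := h1 y; rewrite // inE ys orbT.
Qed.

Lemma admissible_disc n x s : admissible n (x :: s) -> edge_in n (lends x) ->
  (lends x).1 != (lends x).2 ->
  conn (map lends s) (lends x).1 (lends x).2 ->
  (Q * Cmod (lb x) <= Cmod (wden q (la x) (lb x)))%real.
Proof.
move=> adm xn xN cs; have cL := cap_lt adm xn xN cs.
have [h1 h2 _] := adm; have [c0 _] := h1 x (mem_head _ _).
exact: (wclass_disc Q1 (QL c0 cL) (h2 _ _ (perm_refl _) cs)).
Qed.

Lemma perm_cons2P (T : eqType) (x y : T) s t : perm_eq (x :: s) (y :: t) ->
  (x = y /\ perm_eq s t) \/ exists r, perm_eq s (y :: r) /\ perm_eq t (x :: r).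
Proof.
move=> st; have : y \in x :: s by rewrite (perm_mem st) mem_head.
rewrite inE => /orP[/eqP yx|ys].
  by subst y; left; split=> //; rewrite -(perm_cons x).
right; exists (rem y s); split; first exact: perm_to_rem.
rewrite -(perm_cons y) perm_sym; apply: perm_trans _ st.
by rewrite (perm_catCA [:: y] [:: x]) /= perm_cons perm_sym perm_to_rem.
Qed.

(** If the new edge lies on a cycle, so do both halves, and the disc bounds apply to them. A cut
    crossing the new edge crosses one of the halves, whose capacity is at least 1. *)
Lemma admissible_subdivide n u w c1 c2 a1 b1 a2 b2 s :
  u < n -> w < n -> u != w -> all (edge_in n) (map lends s) ->
  admissible n.+1 (((u, n), (c1, (a1, b1))) :: ((n, w), (c2, (a2, b2))) :: s) ->
  admissible n (((u, w), (1, (ser_a q a1 b1 a2 b2, Cmul b1 b2))) :: s).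
Proof.
set x1 : ledge := ((u, n), _); set x2 : ledge := ((n, w), _); set x : ledge := ((u, w), _).
move=> un wn uw wfs adm; have [h1 h2 h3] := adm.
have adm2 : admissible n.+1 (x2 :: x1 :: s).
  by apply: admissible_perm adm; rewrite (perm_catCA [:: x1] [:: x2]).
split.
- move=> y; rewrite inE => /orP[/eqP->|ys]; last by apply: h1; rewrite !inE ys !orbT.
  split=> //; rewrite /la /lb /= wden_ser.
  have [_ d1] : 0 < lcap x1 /\ wden q (la x1) (lb x1) <> Czero by apply: h1; rewrite mem_head.
  have [_ d2] : 0 < lcap x2 /\ wden q (la x2) (lb x2) <> Czero by apply: h1; rewrite !inE eqxx orbT.
  exact: Cmul_neq0.
- move=> y t /perm_cons2P[[<- st]|[r [sr tr]]] cy.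
    have {}cy : conn (map lends s) u w.
      by apply: conn_sub cy => e; rewrite (perm_mem (perm_map lends st)).
    apply: (wclass_ser Q1).
      apply: (admissible_disc adm); rewrite /edge_in /= ?ltnSn ?(ltn_eqF un) //.
        by rewrite andbT; lia.
      move=> S hS /=; have -> : S u = S w.
        by apply: cy => e es; apply: hS; rewrite /= inE es orbT.
      by rewrite -(hS (n, w)) //= mem_head.
    apply: (admissible_disc adm2); rewrite /edge_in /= ?ltnSn ?(gtn_eqF wn) //; first by lia.
    move=> S hS /=; have <- : S u = S w.
      by apply: cy => e es; apply: hS; rewrite /= inE es orbT.
    by rewrite -(hS (u, n)) //= mem_head.
  apply: (h2 y (x1 :: x2 :: r)).
    by apply: (@perm_trans _ (x1 :: x2 :: y :: r)); rewrite ?perm_cons // (perm_catCA [:: x1; x2] [:: y]).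
  move=> S hS; apply: cy => e; rewrite (perm_mem (perm_map lends tr)) inE => /orP[/eqP->|er] /=.
    by rewrite (hS (u, n)) /= ?inE ?eqxx // (hS (n, w)) /= ?inE ?eqxx ?orbT.
  by apply: hS; rewrite /= !inE er !orbT.
- move=> y z yn zn yz; have [S [Syz cS]] := h3 y z (ltnW yn) (ltnW zn) yz.
  exists S; split=> //; apply: leq_trans cS; rewrite !big_cons /crossing /lends /lcap /=.
  have [c10 _] : 0 < lcap x1 /\ wden q (la x1) (lb x1) <> Czero by apply: h1; rewrite mem_head.
  have [c20 _] : 0 < lcap x2 /\ wden q (la x2) (lb x2) <> Czero by apply: h1; rewrite !inE eqxx orbT.
  rewrite /lcap /= in c10 c20.
  by case: (S u); case: (S w); case: (S n) => /=; lia.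
Qed.

(** The two copies form a cycle, so both satisfy the disc bound. Capacities add, which preserves all
    cuts. *)
Lemma admissible_double n e c1 c2 a1 b1 a2 b2 s :
  edge_in n e -> e.1 != e.2 ->
  admissible n ((e, (c1, (a1, b1))) :: (e, (c2, (a2, b2))) :: s) ->
  admissible n ((e, (c1 + c2, (Cmul a1 a2, par_b a1 b1 a2 b2))) :: s).
Proof.
set x1 : ledge := (e, (c1, _)); set x2 : ledge := (e, (c2, _)); set x : ledge := (e, _).
move=> en eN adm; have [h1 h2 h3] := adm.
have adm2 : admissible n (x2 :: x1 :: s).
  by apply: admissible_perm adm; rewrite (perm_catCA [:: x1] [:: x2]).
have ce t : conn (e :: t) e.1 e.2 by move=> S hS; apply: hS; rewrite mem_head.
have [c10 d1] : 0 < lcap x1 /\ wden q (la x1) (lb x1) <> Czero by apply: h1; rewrite mem_head.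
have [c20 d2] : 0 < lcap x2 /\ wden q (la x2) (lb x2) <> Czero by apply: h1; rewrite !inE eqxx orbT.
split.
- move=> y; rewrite inE => /orP[/eqP->|ys]; last by apply: h1; rewrite !inE ys !orbT.
  split; first by rewrite /lcap /= addn_gt0 c10.
  apply: (wden_par_neq0 Q1 d1 d2).
    by apply: (admissible_disc adm) => //; apply: ce.
  by apply: (admissible_disc adm2) => //; apply: ce.
- move=> y t /perm_cons2P[[<- st]|[r [sr tr]]] cy.
    have {}cy : conn (map lends s) e.1 e.2.
      by apply: conn_sub cy => f; rewrite (perm_mem (perm_map lends st)).
    (* The merged edge still lies on a cycle, so a cut between its ends contains a third edge. *)
    have c12 : c1 + c2 < L.
      have /andP[e1 e2] := en; have [S [Se cS]] := h3 _ _ e1 e2 (elimN eqP eN).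
      apply: leq_trans cS; rewrite !big_cons /crossing /lends /= Se.
      rewrite addnA -addn1 leq_add2l; apply: (crossing_gt0 cy Se) => z zs.
      by have [] := h1 z; rewrite // !inE zs !orbT.
    apply: (wclass_par Q1); first by apply: QL => //; rewrite addn_gt0 c10.
      exact: (h2 x1 _ (perm_refl _) (ce _)).
    by apply: (h2 x2 (x1 :: s)); [rewrite (perm_catCA [:: x1] [:: x2]) | apply: ce].
  apply: (h2 y (x1 :: x2 :: r)).
    by apply: (@perm_trans _ (x1 :: x2 :: y :: r)); rewrite ?perm_cons // (perm_catCA [:: x1; x2] [:: y]).
  by apply: conn_sub cy => f; rewrite (perm_mem (perm_map lends tr)) !inE => /orP[->|->]; rewrite ?orbT.
- move=> y z yn zn yz; have [S [Syz cS]] := h3 y z yn zn yz.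
  exists S; split=> //; apply: leq_trans cS; rewrite !big_cons /crossing /lends /lcap /=.
  by case: ifP => _; rewrite ?addnA.
Qed.

(** Cuts and colourings are pulled back along f. *)
Lemma admissible_relabel n f (S : seq (ledge * ledge)) :
  (forall x, x < n -> f x < n) ->
  (forall x y, x < n -> y < n -> f x = f y -> x = y) ->
  all (fun p => relabels f (lends p.1) (lends p.2) && (p.1.2 == p.2.2)) S ->
  admissible n (unzip2 S) -> admissible n (unzip1 S).
Proof.
move=> fn finj /allP rS [h1 h2 h3].
have pull (t : seq (ledge * ledge)) (C : nat -> bool) : {subset t <= S} ->
    (forall e, e \in map lends (unzip2 t) -> C e.1 = C e.2) ->
    forall e, e \in map lends (unzip1 t) -> C (f e.1) = C (f e.2).
  move=> tS hC e; rewrite -map_comp => /mapP[p pt ->] /=.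
  have := hC (lends p.2); rewrite -map_comp (map_f (lends \o snd) pt) => /(_ isT).
  by have /andP[/orP[] /eqP-> _] := rS _ (tS _ pt).
split.
- move=> x /mapP[p pS ->]; have := h1 p.2 (map_f _ pS); have /andP[_ /eqP pE] := rS _ pS.
  by rewrite /lcap /la /lb pE.
- move=> x t /perm_lift[[|p S'] // SS' [<- <-]] cx.
  have pS : p \in S by rewrite (perm_mem SS') mem_head.
  have /andP[rp /eqP pE] := rS _ pS.
  have := h2 p.2 (unzip2 S') (perm_map snd SS'); rewrite /lcap /la /lb pE; apply.
  move=> C hC; have := cx (C \o f) (pull S' C _ hC) => /= cf.
  have {}cf : C (f (lends p.1).1) = C (f (lends p.1).2).
    by apply: cf => z zS'; rewrite (perm_mem SS') inE zS' orbT.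
  by case/orP: rp => /eqP->.
- move=> x y xn yn xy.
  have [C [Cxy cC]] := h3 (f x) (f y) (fn _ xn) (fn _ yn) (fun ff => xy (finj _ _ xn yn ff)).
  exists (C \o f); split=> //; rewrite !big_map in cC *.
  rewrite (_ : \sum_(_ <- S | _) _ = \sum_(p <- S | crossing C p.2) lcap p.2) //.
  rewrite big_seq_cond [RHS]big_seq_cond; apply: eq_big => p.
    case: (boolP (p \in S)) => //= pS; have /andP[rp _] := rS _ pS.
    by rewrite /crossing /=; case/orP: rp => /eqP-> //; rewrite eq_sym.
  by case/andP=> pS _; have /andP[_ /eqP pE] := rS _ pS; rewrite /lcap pE.
Qed.

(** Induction on the construction undoes its last operation. The labels stay general, because each
    reduction creates new weights and capacities. *)
Lemma sp_Zl_neq0 n l s : sp n l -> map lends s = l -> admissible n s -> Zl q n [::] s <> Czero.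
Proof.
move=> sl; elim: sl s => {n l}
  [n l wfl ac|n u w l sl ih|n e l sl ih|n l l' ll' _ ih|n f W fn finj rW sl ih] s sE adm.
- apply: Zl_forest_neq0; rewrite ?sE //; first exact: (q_neq0 Q1).
  by case: adm => h1 _ _ x /h1[].
- have [/= /andP[/andP[un wn] wfl] /andP[uw _]] := sp_edges sl.
  case: s sE adm => [|[e1 [c1 [a1 b1]]] [|[e2 [c2 [a2 b2]]] s]] // [e1E e2E sE] adm.
  rewrite /lends /= in e1E e2E; subst e1 e2.
  rewrite (@Zl_subdivide q n u w c1 c2 1 a1 b1 a2 b2 s) ?sE //.
  apply: ih; first by rewrite /= sE.
  by apply: admissible_subdivide adm; rewrite ?sE.
- have [/= /andP[en _] /andP[eN _]] := sp_edges sl.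
  case: s sE adm => [|[e1 [c1 [a1 b1]]] [|[e2 [c2 [a2 b2]]] s]] // [e1E e2E sE] adm.
  rewrite /lends /= in e1E e2E; subst e1 e2.
  rewrite (@Zl_parallel q n e c1 c2 (c1 + c2) a1 b1 a2 b2 s).
  apply: ih; first by rewrite /= sE.
  exact: admissible_double adm.
- rewrite -sE perm_sym in ll'; have [t st tE] := perm_lift ll'.
  by rewrite (perm_Zl _ _ _ st); apply: ih tE (admissible_perm st adm).
- pose S := [seq ((p.1.1, p.2.2), p.2) | p <- zip W s].
  have szW : size W = size s by rewrite -(size_map lends) sE size_map.
  have S2 : unzip2 S = s by rewrite /unzip2 -map_comp -[RHS](unzip2_zip (s := W)) ?szW.
  have S1 : map lends (unzip1 S) = unzip1 W.
    by rewrite /unzip1 -!map_comp -[in RHS](unzip1_zip (s := W) (t := s)) ?szW // -map_comp.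
  have rS : all (fun p => relabels f (lends p.1) (lends p.2) && (p.1.2 == p.2.2)) S.
    apply/allP=> _ /mapP[p pz ->] /=; rewrite eqxx andbT.
    have -> : lends p.2 = p.1.2.
      have /allP/(_ p pz)/eqP // : all (fun p => lends p.2 == p.1.2) (zip W s).
      elim: W s sE szW {pz rW sl ih adm S S2 S1 fn finj} => [|v W ihW] [|y s] //= [-> sE] [szW].
      by rewrite eqxx ihW.
    have pW : p.1 \in W by rewrite -(unzip1_zip (s := W) (t := s)) ?szW // map_f.
    exact: (allP rW).
  have S1n : all (edge_in n) (map lends (unzip1 S)) by rewrite S1; case: (sp_edges sl).
  have ZE : Zl q n [::] (unzip2 S) = Zl q n [::] (unzip1 S).
    exact: (@Zl_relabel q n f [::] S fn finj isT isT S1n rS).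
  rewrite -S2 ZE; apply: ih S1 _; apply: admissible_relabel fn finj rS _.
  by rewrite S2.
Qed.

End Induction.

(** With unit capacities the capacity of a cut is its number of edges, which Menger's theorem bounds
    by L. *)
Lemma admissible_graph (q : Cx) (L : nat) (G : graph) (v : nat -> R) :
  Rlt 1 (Cmod (Csub q Cone)) -> wf_graph G -> maxmaxflow_le G L ->
  (forall e, e < ne G -> Rle (-1) (v e) /\ Rle (v e) R0) ->
  admissible q L (nv G) (map (real_ledge G v) (iota 0 (ne G))).
Proof.
move=> Q1 wf mmf v01; split.
- move=> x /mapP[e]; rewrite mem_iota => em ->; split=> //.
  exact: (wden_real_neq0 Q1 (v01 e em)).
- move=> x t xt _; have : x \in map (real_ledge G v) (iota 0 (ne G)).
    by rewrite (perm_mem xt) mem_head.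
  case/mapP=> e; rewrite mem_iota => em ->.
  exact: (wclass_real Q1 (v01 e em)).
- move=> x y xn yn xy; have [S [Sxy cS]] := menger wf xn yn xy (mmf x y xn yn xy).
  exists S; split=> //; apply: leq_trans cS; rewrite big_map.
  have -> : iota 0 (ne G) = index_iota 0 (ne G) by rewrite /index_iota subn0.
  rewrite big_mkord big_mkcond.
  by apply: leq_sum => e _; rewrite /crossing /lends /lcap /=; case: (_ != _).
Qed.

Theorem theorem1p5 (L : nat) (hL : (2 <= L)%N) (G : graph) (v : nat -> R) :
  wf_graph G -> loopless G -> series_parallel G -> maxmaxflow_le G L ->
  (forall e, (e < ne G)%N -> Rle (-1) (v e) /\ Rle (v e) R0) ->
  forall q : Cx, Ztutte G q v = Czero ->
    Rlt (Cmod (Csub q Cone)) (Rdiv (Rminus (INR L) R1) (ln (INR 2))).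
Proof.
move=> wf _ spG mmf v01 q Z0; apply: Rnot_le_lt => Qge.
have l1 := ln2_ge; have l2 := ln2_le.
have LQ : (INR L - 1 <= Cmod (Csub q Cone) * ln 2)%real.
  have lp : (0 < ln 2)%real by lra.
  have -> : (INR L - 1 = (INR L - 1) / ln 2 * ln 2)%real by field; lra.
  by apply: Rmult_le_compat_r; [exact: Rlt_le | exact: Qge].
have L2 : (2 <= INR L)%real by apply: (le_INR 2); apply/leP.
(* 1 <= L - 1 <= Q ln 2 and ln 2 <= 7/10. *)
have Q1 : (1 < Cmod (Csub q Cone))%real by nra.
apply: (@sp_Zl_neq0 q L Q1 _ (nv G) (es G) (map (real_ledge G v) (iota 0 (ne G)))).
- move=> c c0 cL; apply: growth_pow_le => //.
  have : (INR c <= INR L - 1)%real.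
    have : (INR c.+1 <= INR L)%real by apply/le_INR/leP.
    by rewrite S_INR; lra.
  by move=> cL'; apply: Rle_trans cL' LQ.
- exact: sp_graph.
- by rewrite -map_comp; apply: mkseq_nth.
- exact: admissible_graph.
- by rewrite -Ztutte_Zl.
Qed.
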